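(* On $F(5)=\mathrm{SU}(5)/T^4$ consider the invariant metric, in the order $(x_{12},x_{13},x_{14},x_{15},x_{23},x_{24},x_{25},x_{34},x_{35},x_{45})$, $$g_4=(M,M,\tfrac12 c,N,M,\tfrac12 c,N,\tfrac12 c,N,L),$$ where $c\approx1.3073$ is the smaller of the two real roots of $P(x)=17500x^6-113750x^5+316325x^4-490500x^3+447800x^2-225550x+48503$ and $$M=\tfrac{8971375}{1666862}c^5-\tfrac{98032375}{3333724}c^4+\tfrac{446084445}{6667448}c^3-\tfrac{68439950}{833431}c^2+\tfrac{357123741}{6667448}c-\tfrac{109792137}{8334310},$$ $$N=\tfrac{268587215}{13334896}-\tfrac{930186785}{13334896}c+\tfrac{1387293825}{13334896}c^2-\tfrac{1110422865}{13334896}c^3+\tfrac{239341375}{6667448}c^4-\tfrac{21499625}{3333724}c^5,$$ $$L=\tfrac{10670625}{3333724}c^5-\tfrac{129829875}{6667448}c^4+\tfrac{654761925}{13334896}c^3-\tfrac{876763875}{13334896}c^2+\tfrac{627815565}{13334896}c-\tfrac{183414881}{13334896}$$ (numerically $(M,\tfrac12c,N,L)\approx(0.64706,0.65364,0.92376,0.47661)$). Then $g_4$ is Einstein, with Einstein constant $\rho$ satisfying $2\rho=1$ (where $\mathrm{Rc}(g_4)=\rho g_4$), it is $G$-non-degenerate and $G$-unstable, and its coindex is $4$.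
   Context: $F(n)=\mathrm{SU}(n)/T^{n-1}$, where $T=T^{n-1}$ is the diagonal maximal torus with Lie algebra $\mathfrak{t}$; $G=\mathrm{SU}(n)$. Let $Q=-B$ be minus the Killing form of $\mathfrak{su}(n)$. There is a $Q$-orthogonal decomposition $\mathfrak{su}(n)=\mathfrak{t}\oplus\bigoplus_{1\le i<j\le n}\mathfrak{p}_{ij}$, where $\mathfrak{p}_{ij}$ is the 2-dimensional space of skew-Hermitian matrices whose only nonzero entries are in positions $(i,j)$ and $(j,i)$; the $\mathfrak{p}_{ij}$ are irreducible and pairwise inequivalent under $\mathrm{Ad}(T)$. Hence every $G$-invariant metric on $F(n)$ is determined by $g=\sum_{i<j}x_{ij}\,Q|_{\mathfrak{p}_{ij}}$ on $\mathfrak{p}=\bigoplus\mathfrak{p}_{ij}\cong T_oF(n)$ with $x_{ij}>0$, and is denoted by the tuple $(x_{ij})$ in lexicographic order. Stability notions. Let $\mathcal M_1^G$ be the manifold of unit-volume $G$-invariant metrics. A metric $g\in\mathcal M_1^G$ is Einstein ($\mathrm{Rc}(g)=\rho g$) iff it is a critical point of the scalar curvature functional $\mathrm{Sc}:\mathcal M_1^G\to\mathbb R$. Let $\mathrm{Sc}''_g$ be the Hessian at such $g$, restricted to the space $\mathcal{TT}_g^G$ of $G$-invariant traceless divergence-free symmetric 2-tensors (here equal to $T_g\mathcal M_1^G$, the $G$-invariant $g$-traceless symmetric 2-tensors). The Einstein metric $g$ is $G$-unstable if $\mathrm{Sc}''_g(T,T)>0$ for some $T\in\mathcal{TT}_g^G$,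 and $G$-non-degenerate if $\mathrm{Sc}''_g|_{\mathcal{TT}_g^G}$ is non-degenerate; its coindex is the maximal dimension of a subspace of $\mathcal{TT}_g^G$ on which $\mathrm{Sc}''_g$ is positive definite. For Einstein metrics not of unit volume, these notions refer to the unit-volume rescaling. *)

(* Defs.v *)
From mathcomp Require Export all_boot all_order all_algebra.
From mathcomp Require Export all_classical all_reals all_analysis.
From mathcomp Require Export complex.

Set Implicit Arguments.
Unset Strict Implicit.
Unset Printing Implicit Defensive.

Import Order.TTheory GRing.Theory Num.Theory.
Import numFieldNormedType.Exports.

Local Open Scope ring_scope.
Local Open Scope complex_scope.

(* The invariant Riemannian geometry of F(n) = SU(n)/T is expressed on the     *)
(* Lie algebra: su(n) = t + p, where t is the space of diagonal matrices and   *)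
(* p, the space of matrices with zero diagonal, is the tangent space of F(n)   *)
(* at the base point.                                                          *)

(* The index set of the summands p_ij.  Indices start at 0. *)
Definition pair_idx (n : nat) : finType := {p : 'I_n * 'I_n | (p.1 < p.2)%N}.

(* Families of reals indexed by i < j.  They represent both invariant metrics  *)
(* and invariant symmetric 2-tensors, see [tensor].                            *)
Definition tuple_of (R : realType) (n : nat) := {ffun pair_idx n -> R^o}.

Definition lex_pairs (n : nat) : seq (nat * nat) :=
  [seq (i, j) | i <- iota 0 n, j <- iota i.+1 (n - i.+1)].

Definition of_lex (R : realType) (n : nat) (s : seq R) : tuple_of R n :=
  [ffun k : pair_idx n =>
     nth 0 s (index (val (val k).1, val (val k).2) (lex_pairs n))].

Section LieAlgebra.
Context {R : realType} {n : nat}.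
Local Notation mat := 'M[R[i]]_n.

Definition in_su (X : mat) : Prop :=
  (forall i j, X i j = - (X j i)^*%C) /\ \tr X = 0.

Definition in_p (X : mat) : Prop :=
  in_su X /\ forall i, X i i = 0.

Definition bracket (X Y : mat) : mat := X *m Y - Y *m X.

Definition proj_t (X : mat) : mat :=
  \matrix_(i, j) (if i == j then X i j else 0).

Definition proj_p (X : mat) : mat :=
  \matrix_(i, j) (if i == j then 0 else X i j).

Definition proj_pk (k : pair_idx n) (X : mat) : mat :=
  \matrix_(i, j)
    (if ((i, j) == val k) || ((j, i) == val k) then X i j else 0).

(* The real basis E_ij - E_ji, 'i (E_ij + E_ji) (i < j) of p, with the         *)
(* corresponding coordinates.                                                  *)
Definition basis_p (a : pair_idx n * bool) : mat :=
  let: (i, j) := val a.1 in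
  if a.2 then (0 +i* 1) *: (delta_mx i j + delta_mx j i)
  else delta_mx i j - delta_mx j i.

Definition coord_p (a : pair_idx n * bool) (X : mat) : R :=
  let: (i, j) := val a.1 in
  if a.2 then complex.Im (X i j) else complex.Re (X i j).

(* The real basis 'i (E_kk - E_ll) of t, where l is the last index and k != l; *)
(* the coordinate along it of a diagonal X in su(n) is Im (X k k).             *)
Definition basis_t (k : 'I_n) : mat :=
  \matrix_(i, j) (if i == j
                  then (if i == k then 0 +i* 1
                        else if i.+1 == n then 0 -i* 1 else 0)
                  else 0).

(* Traces of real-linear endomorphisms of p and of su(n). *)
Definition trace_p (f : mat -> mat) : R := \sum_a coord_p a (f (basis_p a)).

Definition trace_su (f : mat -> mat) : R :=
  trace_p f + \sum_(k < n | (k.+1 < n)%N) complex.Im (f (basis_t k) k k).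

Definition killing (X Y : mat) : R :=
  trace_su (fun Z => bracket X (bracket Y Z)).

Definition Qform (X Y : mat) : R := - killing X Y.

(* The bilinear form \sum_(i < j) v_ij Q|p_ij on p. *)
Definition tensor (v : tuple_of R n) (X Y : mat) : R :=
  \sum_k v k * Qform (proj_pk k X) (proj_pk k Y).

Definition is_metric (x : tuple_of R n) : Prop := forall k, 0 < x k.

(* The trace with respect to the metric x of a bilinear form b on p; the       *)
(* vectors [basis_p a] are orthogonal for every invariant metric.              *)
Definition metric_trace (x : tuple_of R n) (b : mat -> mat -> R) : R :=
  \sum_a b (basis_p a) (basis_p a) / tensor x (basis_p a) (basis_p a).

(* The Levi-Civita connection of the metric x as a bilinear map p -> p -> p    *)
(* (Nomizu map): [levi_civita x X Y] is the element of p such that             *)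
(*   2 g(levi_civita x X Y, Z) =                                               *)
(*     g([X, Y]_p, Z) + g([Z, X]_p, Y) + g(X, [Z, Y]_p)   for all Z in p,      *)
(* expanded in the g-orthogonal basis [basis_p].                               *)
Definition levi_civita (x : tuple_of R n) (X Y : mat) : mat :=
  let g := tensor x in
  \sum_a
    ((g (proj_p (bracket X Y)) (basis_p a)
      + g (proj_p (bracket (basis_p a) X)) Y
      + g X (proj_p (bracket (basis_p a) Y)))
     / (2 * g (basis_p a) (basis_p a)))%:C *: basis_p a.

(* R(X,Y)Z = [L(X), L(Y)]Z - L([X,Y]_p)Z - [[X,Y]_t, Z]  with L = levi_civita. *)
Definition curvature (x : tuple_of R n) (X Y Z : mat) : mat :=
  let nabla := levi_civita x in
  nabla X (nabla Y Z) - nabla Y (nabla X Z)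
  - nabla (proj_p (bracket X Y)) Z - bracket (proj_t (bracket X Y)) Z.

Definition Ricci (x : tuple_of R n) (Y Z : mat) : R :=
  trace_p (fun X => curvature x X Y Z).

Definition scalar_curvature (x : tuple_of R n) : R := metric_trace x (Ricci x).

Definition Einstein (x : tuple_of R n) (rho : R) : Prop :=
  forall X Y, in_p X -> in_p Y -> Ricci x X Y = rho * tensor x X Y.

(* Riemannian volume of the metric x.  [volQ] stands for the volume of F(n)    *)
(* with the metric Q; each x_ij scales a 2-dimensional summand, so that the    *)
(* volume density relative to Q is the product of the x_ij.                    *)
Definition volume (volQ : R) (x : tuple_of R n) : R := volQ * \prod_k x k.

(* F(n) has dimension 2 #|pair_idx n|, and scaling a metric by r scales the    *)
(* volume by r ^ (dim / 2).                                                    *)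
Definition unit_rescaling (volQ : R) (x : tuple_of R n) : tuple_of R n :=
  let dim : R := (2 * #|pair_idx n|)%:R in
  (volume volQ x `^ (- (2 / dim))) *: x.

(* The tangent space to the unit-volume invariant metrics at x: invariant      *)
(* symmetric 2-tensors with vanishing x-trace.                                 *)
Definition TT (x v : tuple_of R n) : Prop := metric_trace x (tensor v) = 0.

(* A chart at x of the space of invariant metrics.  It has differential the    *)
(* identity at 0 and maps TT x into the metrics with the same volume as x.     *)
Definition chart (x v : tuple_of R n) : tuple_of R n :=
  [ffun k => x k * expR (v k / x k)].

(* The Hessian of Sc on the metrics of fixed volume, as the mixed second       *)
(* derivative in the chart above.  It is used only for v, w in TT x and at     *)
(* critical points (Einstein metrics), where it depends on no choice of chart. *)
Definition Sc_hessian (x v w : tuple_of R n) : R :=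
  derive1 (fun s : R =>
    derive1 (fun t : R => scalar_curvature (chart x (s *: v + t *: w))) 0) 0.

Definition unstable (x : tuple_of R n) : Prop :=
  exists v, TT x v /\ 0 < Sc_hessian x v v.

Definition nondegenerate (x : tuple_of R n) : Prop :=
  forall v, TT x v -> (forall w, TT x w -> Sc_hessian x v w = 0) -> v = 0.

Definition positive_subspace (x : tuple_of R n) (U : {vspace tuple_of R n}) :
    Prop :=
  (forall v, v \in U -> TT x v) /\
  (forall v, v \in U -> v != 0 -> 0 < Sc_hessian x v v).

Definition coindex (x : tuple_of R n) (d : nat) : Prop :=
  (exists U : {vspace tuple_of R n}, positive_subspace x U /\ \dim U = d) /\
  (forall U : {vspace tuple_of R n}, positive_subspace x U -> (\dim U <= d)%N).

End LieAlgebra.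

(* Main.v *)
(* Extend a tuple x to a symmetric matrix and let o be the entrywise product.  *)
(* Invariance of the trace form turns Koszul's formula into                    *)
(*   nabla_X Y = 1/2 ([X, Y]_p + x^-1 o ([X, x o Y] + [Y, x o X])),            *)
(* which extends complex-bilinearly to all matrices, so that traces over p can *)
(* be computed on the elementary matrices E_ij.  This gives                    *)
(*   Ric = 1/2 + 1/(4n) sum_l (x_ij^2 - x_il^2 - x_lj^2) / (x_il x_lj)         *)
(* as the coefficient of Q on p_ij.  In the chart x exp(v / x) the scalar      *)
(* curvature is a finite sum of exponentials of linear forms in u = v / x,     *)
(* hence its Hessian is, explicitly,                                           *)
(*   sum u_k^2 / x_k - 1/(2n) sum x_k / (x_l x_m) (u_k - u_l - u_m)^2,         *)
(* the second sum being over triangles with a marked edge k.                   *)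
(* For g4 the Einstein equations are polynomial identities modulo P(c) = 0.    *)
(* The Hessian of g4 is invariant under S_3 permuting the first three indices: *)
(* traceless tensors split as 3 trivial + 3 standard representations, and the  *)
(* form has signature (2, 1) on the trivial and (1, 2) on the standard         *)
(* multiplicity space.  Hence the coindex is 2 + 2 * 1 = 4.                    *)

Require Import Defs.
From HB Require Import structures.
From mathcomp Require Import polyrcf.
From mathcomp Require Import ring lra.
Set Implicit Arguments.
Unset Strict Implicit.
Unset Printing Implicit Defensive.
Import Order.TTheory GRing.Theory Num.Theory.
Import numFieldNormedType.Exports.
Local Open Scope ring_scope.
Local Open Scope complex_scope.

(** * Traces and the Killing form *)

(** Everything is reduced to explicit rational functions of the entries of the metric. On p the
    Killing form is 2n times the real trace form ([killing_in_p]), so invariant tensors are weighted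
    traces ([tensorE]) and Koszul's formula is solved by the matrix [lc] ([levi_civitaE]). Since
    [lc] is complex-bilinear, Ricci is a trace over the elementary matrices E_ij, and it comes out
    diagonal ([RicciE]). For g4 the Einstein condition becomes four polynomial equations ([ric_g4]),
    and the second variation of the scalar curvature an explicit quadratic form ([Sc_hessianE]).

    For stability no eigenvalue is computed. The traceless tensors have dimension 9; it is enough to
    exhibit a 4-dimensional subspace on which the Hessian is positive ([Sc_hessian_pos]) and a
    5-dimensional complement on which it is negative ([Sc_hessian_neg]). The form is then
    non-degenerate ([split_nondegenerate]), and a positive subspace meets the complement only in 0,
    hence has dimension at most 4 ([split_coindex]). The S_3 symmetry reduces definiteness to the
    signs of a few numbers and 2 by 2 determinants ([hess_g4], [hess_coefs_sign]), which are decided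
    by rational enclosures of M, c/2, N, L coming from an isolating interval of c ([polyP_roots],
    [numerical_values]). In relative variations, passing to unit volume multiplies the form by a
    positive factor ([hess_scale]). *)

Section ComplexParts.
Context {R : realType}.
Local Notation Re := (@complex.Re R).
Local Notation Im := (@complex.Im R).
Implicit Types z w : R[i].

Lemma ReD z w : Re (z + w) = Re z + Re w. Proof. by case: z; case: w. Qed.
Lemma ReN z : Re (- z) = - Re z. Proof. by case: z. Qed.
Lemma ReB z w : Re (z - w) = Re z - Re w. Proof. by rewrite ReD ReN. Qed.

Lemma ReMl (a : R) z : Re (a%:C * z) = a * Re z.
Proof. by case: z => x y /=; rewrite mul0r subr0. Qed.

Lemma ImMi z : Im ((0 +i* 1) * z) = Re z.
Proof. by case: z => x y /=; rewrite mul0r add0r mul1r. Qed.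

Lemma ReJ z : Re (z^*%C) = Re z. Proof. by case: z. Qed.

Lemma Re_sum I (r : seq I) (P : pred I) (f : I -> R[i]) :
  Re (\sum_(i <- r | P i) f i) = \sum_(i <- r | P i) Re (f i).
Proof. exact: (big_morph Re ReD). Qed.

Lemma conjcM z w : (z * w)^*%C = z^*%C * w^*%C.
Proof. exact: rmorphM. Qed.

Lemma conjcMl (a : R) z : (a%:C * z)^*%C = a%:C * z^*%C.
Proof. by rewrite conjcM [X in X * _]conjc_real. Qed.

Lemma conjcB z w : (z - w)^*%C = z^*%C - w^*%C.
Proof. exact: rmorphB. Qed.

Lemma conjc_sum I (r : seq I) (P : pred I) (f : I -> R[i]) :
  (\sum_(i <- r | P i) f i)^*%C = \sum_(i <- r | P i) (f i)^*%C.
Proof. exact: rmorph_sum. Qed.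

End ComplexParts.

Section PairSums.
Context {R : realType} {n : nat}.
Implicit Types (v x : tuple_of R n) (k : pair_idx n).

(* The symmetric extension of a tuple, with the junk value 0 on the diagonal. *)
Definition sym v (i j : 'I_n) : R :=
  if insub (i, j) is Some k then v k
  else if insub (j, i) is Some k then v k else 0.

Lemma symC v i j : sym v i j = sym v j i.
Proof.
rewrite /sym; case: insubP => [k /= ij _|/= ij].
  by rewrite insubN //= -leqNgt ltnW.
by case: insubP.
Qed.

Lemma sym_diag v i : sym v i i = 0.
Proof. by rewrite /sym insubN //= ltnn. Qed.

Lemma sym_val v k : sym v (val k).1 (val k).2 = v k.
Proof. by rewrite /sym -surjective_pairing valK. Qed.

(** Transfers facts about tuples to [sym] at arbitrary distinct indices, by checking both
    orientations of each pair. *)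
Lemma symP v (P : 'I_n -> 'I_n -> R -> Prop) :
  (forall k, P (val k).1 (val k).2 (v k)) ->
  (forall k, P (val k).2 (val k).1 (v k)) ->
  forall i j, i != j -> P i j (sym v i j).
Proof.
move=> P1 P2 i j; rewrite neq_ltn => /orP[] ij.
  by have := P1 (Sub (i, j) ij : pair_idx n); rewrite -sym_val SubK.
by have := P2 (Sub (j, i) ij : pair_idx n); rewrite -sym_val SubK symC.
Qed.

Lemma sum_pair_idx (F : 'I_n -> 'I_n -> R) :
  \sum_(k : pair_idx n) F (val k).1 (val k).2 =
  \sum_(i < n) \sum_(j < n | (i < j)%N) F i j.
Proof.
rewrite pair_big_dep /=.
rewrite (reindex_omap (val : pair_idx n -> 'I_n * 'I_n) insub) /=.
  by apply: eq_bigl => k; rewrite (valP k) valK eqxx.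
by move=> p pP; rewrite insubT.
Qed.

Lemma sum_offdiag (G : 'I_n -> 'I_n -> R) :
  (forall i, G i i = 0) ->
  \sum_i \sum_j G i j = \sum_(k : pair_idx n)
     (G (val k).1 (val k).2 + G (val k).2 (val k).1).
Proof.
move=> G0; rewrite big_split /= sum_pair_idx.
rewrite (sum_pair_idx (fun i j => G j i)).
rewrite [X in _ + X](exchange_big_dep xpredT) //= -big_split /=.
apply: eq_bigr => i _; rewrite (bigID (fun j : 'I_n => i < j)%N) /=.
congr (_ + _); rewrite (bigD1 i) ?ltnn //= G0 add0r.
by apply: eq_bigl => j; rewrite -leqNgt ltn_neqAle andbC.
Qed.

End PairSums.

Section Traces.
Context {R : realType} {n : nat}.
Local Notation mat := 'M[R[i]]_n.
Local Notation Re := (@complex.Re R).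
Implicit Types (X Y Z : mat) (v x : tuple_of R n).

(** Complex linearity allows a real trace to be evaluated on the elementary matrices E_ij, although
    these do not lie in p. *)
Definition clinear (f : mat -> mat) :=
  forall (a : R[i]) X Y, f (a *: X + Y) = a *: f X + f Y.

Lemma eq_trace_p (f g : mat -> mat) :
  (forall a, f (basis_p a) = g (basis_p a)) -> trace_p f = trace_p g.
Proof. by move=> fg; apply: eq_bigr => a _; rewrite fg. Qed.

Lemma clinear0 f : clinear f -> f 0 = 0.
Proof. by move=> lf; have := lf (-1) 0 0; rewrite !scaleN1r !addNr. Qed.

Lemma clinearZ f (a : R[i]) X : clinear f -> f (a *: X) = a *: f X.
Proof. by move=> lf; rewrite -[a *: X]addr0 lf clinear0 // addr0. Qed.

Lemma clinearD f X Y : clinear f -> f (X + Y) = f X + f Y.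
Proof. by move=> lf; rewrite -[X]scale1r lf !scale1r. Qed.

Lemma clinearB f X Y : clinear f -> f (X - Y) = f X - f Y.
Proof. by move=> lf; rewrite clinearD // -scaleN1r clinearZ // scaleN1r. Qed.

(* For a complex-linear f the contributions of f (E_ji) to the two basis       *)
(* vectors of p_ij cancel.                                                     *)
Lemma trace_p_clinear (f : mat -> mat) : clinear f ->
  trace_p f = \sum_(k : pair_idx n)
    2 * Re (f (delta_mx (val k).1 (val k).2) (val k).1 (val k).2).
Proof.
move=> lf; pose F k b := coord_p (k, b) (f (basis_p (k, b))).
rewrite /trace_p (eq_bigr (fun a => F a.1 a.2)) => [|[] //].
rewrite -(pair_bigA _ F) /F.
apply: eq_bigr => k _; rewrite big_bool /coord_p /basis_p /=.
case: (val k) => i j /=.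
by rewrite clinearZ // clinearB // clinearD // !mxE ImMi !ReD ReN; ring.
Qed.

Lemma mul_delta_mulE (A B : mat) (i j k l : 'I_n) :
  (A *m delta_mx i j *m B) k l = A k i * B j l.
Proof.
rewrite mxE (bigD1 j) //= big1 ?addr0 => [|j' j'j]; rewrite mxE (bigD1 i) //=.
  rewrite big1 ?addr0 => [|i' i'i]; last by rewrite mxE (negPf i'i) mulr0.
  by rewrite mxE !eqxx mulr1.
rewrite mxE (negPf j'j) andbF mulr0 add0r big1 ?mul0r // => i' i'i.
by rewrite mxE (negPf i'i) mulr0.
Qed.

Lemma mul_deltaE (A : mat) (i j k l : 'I_n) :
  (A *m delta_mx i j) k l = A k i * (j == l)%:R.
Proof. by rewrite -[A *m _]mulmx1 mul_delta_mulE mxE. Qed.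

Lemma delta_mulE (B : mat) (i j k l : 'I_n) :
  (delta_mx i j *m B) k l = (k == i)%:R * B j l.
Proof. by rewrite -[delta_mx i j]mul1mx mul_delta_mulE mxE. Qed.

End Traces.

Section Killing.
Context {R : realType} {n : nat}.
Local Notation mat := 'M[R[i]]_n.
Local Notation Re := (@complex.Re R).
Implicit Types X Y Z : mat.

Lemma in_pE X : in_p X <-> (forall i j, X i j = - (X j i)^*%C) /\ forall i, X i i = 0.
Proof.
split=> [[[XH _] X0] //|[XH X0]]; split=> //; split=> //.
by rewrite /mxtrace big1.
Qed.

Lemma bracket_linear_r (X Y Z : mat) (a : R[i]) :
  bracket X (a *: Y + Z) = a *: bracket X Y + bracket X Z.
Proof.
rewrite /bracket mulmxDr mulmxDl -scalemxAl -scalemxAr scalerBr.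
by rewrite addrACA opprD.
Qed.

Lemma bracketC (X Y : mat) : bracket X Y = - bracket Y X.
Proof. by rewrite /bracket opprB. Qed.

Lemma bracket_linear_l (X Y Z : mat) (a : R[i]) :
  bracket (a *: Y + Z) X = a *: bracket Y X + bracket Z X.
Proof. by rewrite bracketC bracket_linear_r opprD -scalerN -!bracketC. Qed.

Lemma bracket_bracket_delta X Y (i j k l : 'I_n) :
  bracket X (bracket Y (delta_mx i j)) k l =
  (X *m Y) k i * (j == l)%:R - X k i * Y j l - Y k i * X j l
  + (k == i)%:R * (Y *m X) j l.
Proof.
have entry (A B C D : mat) :
    (A - B - (C - D)) k l = A k l - B k l - C k l + D k l.
  by rewrite !mxE; ring.
rewrite /bracket mulmxBr mulmxBl !mulmxA -(mulmxA (delta_mx i j)) entry.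
by rewrite mul_deltaE !mul_delta_mulE delta_mulE.
Qed.

Lemma Re_mulmx_diag X Y i : in_p X -> in_p Y ->
  Re ((Y *m X) i i) = Re ((X *m Y) i i).
Proof.
move=> [[XH _] _] [[YH _] _]; rewrite !mxE !Re_sum; apply: eq_bigr => j _.
rewrite (XH j i) (YH i j) mulrNN -ReJ rmorphM /= !conjcK mulrC //.
Qed.

End Killing.

Lemma basis_tE (R : realType) (m : nat) (k : 'I_m.+1) : k != ord_max ->
  basis_t k = (0 +i* 1) *: (delta_mx k k - delta_mx ord_max ord_max)
    :> 'M[R[i]]_m.+1.
Proof.
move=> kl; apply/matrixP => i j; rewrite !mxE.
have [<-|ij] := eqVneq i j; last first.
  have -> : (i == k) && (j == k) = false.
    by apply/negP => /andP[/eqP ik /eqP jk]; rewrite ik jk eqxx in ij.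
  have -> : (i == ord_max) && (j == ord_max) = false.
    by apply/negP => /andP[/eqP ik /eqP jk]; rewrite ik jk eqxx in ij.
  by rewrite subrr mulr0.
rewrite !andbb; have [->|ik] := eqVneq i k.
  by rewrite (negPf kl) subr0 mulr1.
rewrite eqSS -[(_ == m)]/(i == ord_max :> nat) -[(_ == _ :> nat)]/(i == ord_max).
case: eqP => _; last by rewrite subrr mulr0.
by rewrite sub0r mulrN1; apply/eqP; rewrite eq_complex /= oppr0 !eqxx.
Qed.

Lemma Im_basis_t (R : realType) (m : nat) (f : 'M[R[i]]_m.+1 -> 'M[R[i]]_m.+1)
    (k : 'I_m.+1) : clinear f -> k != ord_max ->
  complex.Im (f (basis_t k) k k) =
  complex.Re (f (delta_mx k k) k k - f (delta_mx ord_max ord_max) k k).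
Proof.
move=> lf kl; rewrite basis_tE // clinearZ // clinearB // mxE ImMi.
by congr complex.Re; rewrite !mxE.
Qed.

Section Killing2.
Context {R : realType}.
Local Notation Re := (@complex.Re R).

(** With q_i the real part of (XY)_ii and S the sum of the q_i, the summand p_ij contributes 2(q_i +
    q_j) to the trace. Over all pairs this adds up to 2(n - 1)S, and the torus part contributes the
    missing 2S. *)
Lemma killing_in_p (n : nat) (X Y : 'M[R[i]]_n) : in_p X -> in_p Y ->
  killing X Y = (2 * n)%:R * Re (\tr (X *m Y)).
Proof.
case: n X Y => [|m] X Y pX pY.
  rewrite mul0r /killing /trace_su /trace_p big1 => [|[[[[]]]] //].
  by rewrite add0r big_ord0.
have [_ X0] := pX; have [_ Y0] := pY.
pose q i := Re ((X *m Y) i i); pose S := \sum_i q i.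
have -> : Re (\tr (X *m Y)) = S by rewrite /mxtrace Re_sum.
pose f Z := bracket X (bracket Y Z).
have lf : clinear f by move=> a U V; rewrite /f !bracket_linear_r.
rewrite /killing /trace_su -/f trace_p_clinear //.
have -> : \sum_(k : pair_idx m.+1)
    2 * Re (f (delta_mx (val k).1 (val k).2) (val k).1 (val k).2) =
    2 * m%:R * S.
  pose G (i j : 'I_m.+1) := if i == j then 0 else q i + q j.
  transitivity (\sum_i \sum_j G i j).
    rewrite sum_offdiag => [|i]; last by rewrite /G eqxx.
    apply: eq_bigr => -[[i j] /= ij] _; rewrite /f bracket_bracket_delta.
    rewrite !eqxx /G -[j == i]/(val j == val i) -[i == j]/(val i == val j).
    rewrite ltn_eqF // gtn_eqF // !X0 !Y0 !mul0r !subr0 mulr1 mul1r ReD.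
    by rewrite (Re_mulmx_diag _ pX pY) /q; ring.
  have -> : \sum_i \sum_j G i j = \sum_i (m.+1%:R * q i + S - 2 * q i).
    apply: eq_bigr => i _.
    have -> : m.+1%:R * q i + S = \sum_j (q i + q j).
      by rewrite big_split /= sumr_const card_ord mulr_natl.
    rewrite (bigD1 i) //= [in RHS](bigD1 i) //= /G eqxx add0r.
    rewrite [RHS](_ : _ = \sum_(j | j != i) (q i + q j)); last by ring.
    by apply: eq_bigr => j ji; rewrite eq_sym (negPf ji).
  rewrite sumrB big_split /= -!mulr_sumr -/S sumr_const card_ord -mulr_natl.
  by rewrite -natr1; ring.
have -> : \sum_(k < m.+1 | (k.+1 < m.+1)%N) complex.Im (f (basis_t k) k k) =
    2 * S.
  have -> : 2 * S = \sum_k Re ((X *m Y) k k + (Y *m X) k k).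
    rewrite /S mulr_sumr; apply: eq_bigr => k _.
    by rewrite ReD (Re_mulmx_diag _ pX pY) /q; ring.
  rewrite [RHS](bigD1 ord_max) //=.
  (* The index [ord_max] has no basis vector of t of its own; its diagonal entry is recovered from
     the cross terms of the other basis vectors. *)
  have -> : (X *m Y) ord_max ord_max + (Y *m X) ord_max ord_max =
      \sum_(k | k != ord_max) (X k ord_max * Y ord_max k
                               + Y k ord_max * X ord_max k).
    rewrite !mxE -big_split /= (bigD1 ord_max) //= X0 Y0 !mul0r add0r add0r.
    by apply: eq_bigr => k _; ring.
  rewrite Re_sum -big_split /=.
  have P (k : 'I_m.+1) : (k.+1 < m.+1)%N = (k != ord_max).
    by rewrite ltnS ltn_neqAle -ltnS ltn_ord andbT.
  rewrite (eq_bigl _ _ P); apply: eq_bigr => k kl.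
  transitivity (Re (f (delta_mx k k) k k - f (delta_mx ord_max ord_max) k k)).
    exact: Im_basis_t.
  have H1 := bracket_bracket_delta X Y k k k k.
  have H2 := bracket_bracket_delta X Y ord_max ord_max k k.
  apply: etrans (congr1 Re (congr2 (fun a b => a - b) H1 H2)) _.
  rewrite !eqxx [ord_max == k]eq_sym !(negPf kl) /=.
  by rewrite !X0 !Y0 -ReD; congr Re; ring.
by rewrite natrM -natr1; ring.
Qed.

End Killing2.

Section Tensors.
Context {R : realType} {n : nat}.
Local Notation mat := 'M[R[i]]_n.
Local Notation Re := (@complex.Re R).
Implicit Types (X Y Z : mat) (v x : tuple_of R n) (k : pair_idx n).

Definition wtr v X Y : R[i] :=
  \sum_i \sum_j (sym v i j)%:C * (X i j * Y j i).

Lemma wtrC v X Y : wtr v X Y = wtr v Y X.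
Proof.
rewrite /wtr exchange_big /=; apply: eq_bigr => i _; apply: eq_bigr => j _.
by rewrite symC [X _ _ * _]mulrC.
Qed.

Lemma wtr_projl v X Y : wtr v (proj_p X) Y = wtr v X Y.
Proof.
apply: eq_bigr => i _; apply: eq_bigr => j _; rewrite mxE.
by case: eqP => // ->; rewrite sym_diag !mul0r.
Qed.

Lemma pair_idx_neq k k' : ((val k).2, (val k).1) == val k' = false.
Proof.
apply/negP => /eqP kk'; have := valP k'; rewrite -kk' /= ltnNge.
by rewrite (ltnW (valP k)).
Qed.

Lemma proj_pk_in_p k X : in_p X -> in_p (proj_pk k X).
Proof.
rewrite !in_pE => -[XH X0]; split=> [i j|i]; rewrite !mxE; last first.
  by rewrite X0 if_same.
by rewrite orbC; case: ifP => _; [exact: XH|by rewrite rmorph0 oppr0].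
Qed.

Lemma tensorE v X Y : in_p X -> in_p Y ->
  tensor v X Y = - ((2 * n)%:R * Re (wtr v X Y)).
Proof.
move=> pX pY; have [_ X0] := pX.
rewrite /wtr Re_sum (eq_bigr (fun i =>
  \sum_j Re ((sym v i j)%:C * (X i j * Y j i)))); last first.
  by move=> i _; rewrite Re_sum.
rewrite sum_offdiag => [|i]; last by rewrite sym_diag mul0r.
rewrite -mulNr mulr_sumr; apply: eq_bigr => k _.
rewrite /Qform killing_in_p; [|exact: proj_pk_in_p|exact: proj_pk_in_p].
rewrite /mxtrace Re_sum (eq_bigr (fun i =>
  \sum_j Re (proj_pk k X i j * proj_pk k Y j i))); last first.
  by move=> i _; rewrite mxE Re_sum.
rewrite sum_offdiag => [|i]; last by rewrite !mxE X0 if_same mul0r.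
rewrite (bigD1 k) //= big1 ?addr0 => [|k' k'k]; last first.
  rewrite !mxE -!surjective_pairing !pair_idx_neq !(inj_eq val_inj).
  by rewrite (negPf k'k) /= !(mul0r, subrr, addr0).
rewrite !mxE -!surjective_pairing !pair_idx_neq !eqxx /= !ReMl.
by rewrite [sym v (val k).2 _]symC sym_val; ring.
Qed.

Lemma basis_pE k b i j : basis_p (k, b) i j =
  if (i, j) == val k then if b then (0 +i* 1) else 1
  else if (j, i) == val k then if b then (0 +i* 1) else -1 else 0 :> R[i].
Proof.
rewrite /basis_p /=; case kE: (val k) => [k1 k2].
have := valP k; rewrite kE /= !xpair_eqE => k12.
have k21 : k2 == k1 = false by apply/eqP => kk; rewrite kk ltnn in k12.
case: b; rewrite !mxE; case: eqP => [->|_]; case: eqP => [->|_];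
  rewrite ?eqxx ?k21 ?(eq_sym k1) ?k21 /= ?andbF /=;
  rewrite ?addr0 ?add0r ?mulr1 ?mulr0 ?subr0 ?sub0r ?subrr ?oppr0 //;
  by rewrite andbC; case: (_ && _); rewrite ?mulr1 ?mulr0 ?oppr0.
Qed.

Lemma basis_p_in_p a : in_p (basis_p a : mat).
Proof.
case: a => k b; rewrite in_pE; split=> [i j|i]; rewrite !basis_pE.
  case: eqP => [ij|_]; case: eqP => [ji|_] //.
  - by have := pair_idx_neq k k; rewrite -ij /= ji ij eqxx.
  - case: b; apply/eqP; rewrite eq_complex /=;
    by rewrite ?oppr0 ?opprK ?eqxx.
  - case: b; apply/eqP; rewrite eq_complex /=;
    by rewrite ?oppr0 ?opprK ?eqxx.
  - by rewrite rmorph0 oppr0.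
have iik : ((i, i) == val k) = false.
  by apply/eqP => ik; have := valP k; rewrite -ik ltnn.
by rewrite iik.
Qed.

Lemma p_basis_expansion X : in_p X ->
  X = \sum_a (coord_p a X)%:C *: basis_p a.
Proof.
rewrite in_pE => -[XH X0].
pose F k b : mat := (coord_p (k, b) X)%:C *: basis_p (k, b).
rewrite (eq_bigr (fun a => F a.1 a.2)) => [|[] //].
rewrite -(pair_bigA _ F) /=; apply/matrixP => i j; rewrite summxE.
have E k : (\sum_b F k b) i j =
    if (i, j) == val k then X i j
    else if (j, i) == val k then X i j else 0.
  rewrite big_bool /F mxE [X in X + _]mxE [X in _ + X]mxE !basis_pE /coord_p /=.
  case kE : (val k) => [k1 k2] /=.
  case: eqP => [[-> ->]|_].
    case: (X k1 k2) => a b; apply/eqP; rewrite eq_complex /=.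
    by apply/andP; split; apply/eqP; ring.
  case: eqP => [[-> ->]|_]; last by rewrite !mulr0 addr0.
  rewrite (XH k2 k1); case: (X k1 k2) => a b; apply/eqP; rewrite eq_complex /=.
  by apply/andP; split; apply/eqP; ring.
under eq_bigr => k _ do rewrite E.
case: (ltngtP i j) => [ij|ij|/val_inj ij]; last first.
- rewrite ij X0 big1 // => k _.
  by rewrite !if_same.
- pose k0 : pair_idx n := Sub (j, i) ij; have k0E : (j, i) = val k0 by [].
  rewrite (bigD1 k0) // big1 => [|k kk0].
    by rewrite k0E eqxx if_same /= addr0.
  rewrite k0E (inj_eq val_inj) [k0 == k]eq_sym (negPf kk0).
  by case: eqP => // ijk; have := valP k; rewrite -ijk /= ltnNge ltnW.
- pose k0 : pair_idx n := Sub (i, j) ij; have k0E : (i, j) = val k0 by [].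
  rewrite (bigD1 k0) // big1 => [|k kk0].
    by rewrite k0E eqxx /= addr0.
  rewrite k0E (inj_eq val_inj) [k0 == k]eq_sym (negPf kk0).
  by case: eqP => // jik; have := valP k; rewrite -jik /= ltnNge ltnW.
Qed.

(** Orthogonality of the basis for all invariant tensors at once. The factor 4n is 2n from the
    Killing form, doubled because both positions of a pair contribute. *)
Lemma tensor_basis v X k b : in_p X ->
  tensor v X (basis_p (k, b)) = (4 * n)%:R * v k * coord_p (k, b) X.
Proof.
move=> pX; rewrite tensorE //; last exact: basis_p_in_p.
move: pX; rewrite in_pE => -[XH X0].
rewrite /wtr Re_sum (eq_bigr (fun i =>
  \sum_j Re ((sym v i j)%:C * (X i j * basis_p (k, b) j i)))); last first.
  by move=> i _; rewrite Re_sum.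
rewrite sum_offdiag => [|i]; last by rewrite sym_diag mul0r.
rewrite (bigD1 k) //= big1 ?addr0 => [|k' k'k]; last first.
  rewrite !ReMl !basis_pE -!surjective_pairing !pair_idx_neq.
  by rewrite !(inj_eq val_inj) (negPf k'k) !mulr0 addr0.
rewrite !ReMl !basis_pE -!surjective_pairing !pair_idx_neq eqxx.
rewrite [sym v (val k).2 _]symC sym_val /coord_p /=.
rewrite (XH (sval k).2); case: (sval k) => k1 k2 /=.
by case: b; case: (X k1 k2) => c d /=; ring.
Qed.

End Tensors.

(** * Levi-Civita connection *)

Section LeviCivita.
Context {R : realType} {n : nat}.
Local Notation mat := 'M[R[i]]_n.
Local Notation Re := (@complex.Re R).
Implicit Types (X Y Z e : mat) (v x : tuple_of R n).

Lemma sym_gt0 x i j : is_metric x -> i != j -> 0 < sym x i j.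
Proof. by move=> x0; apply: (@symP _ _ _ (fun _ _ r => 0 < r)). Qed.

(* It is 0 for i = j, because sym x i i = 0 and 0^-1 = 0. *)
Definition lam x (i k j : 'I_n) : R :=
  (sym x i j + sym x k j - sym x i k) / (2 * sym x i j).

(** The entry of 1/2 ([X, Y]_p + x^-1 o ([X, x o Y] + [Y, x o X])), o being the entrywise product,
    with the coefficients of each product collected in [lam]. The vanishing of [lam] for equal outer
    indices performs the projection to p. *)
Definition lc_entry x X Y (i j : 'I_n) : R[i] :=
  \sum_k ((lam x i k j)%:C * (X i k * Y k j)
          - (lam x j k i)%:C * (Y i k * X k j)).

Definition lc x X Y : mat := \matrix_(i, j) lc_entry x X Y i j.

Lemma lam_diag x (i k : 'I_n) : lam x i k i = 0.
Proof. by rewrite /lam sym_diag mulr0 invr0 mulr0. Qed.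

Lemma lamE x (i k j : 'I_n) : is_metric x -> i != j ->
  2 * (sym x i j)%:C * (lam x i k j)%:C =
  (sym x i j)%:C + (sym x k j)%:C - (sym x i k)%:C :> R[i].
Proof.
move=> x0 ij; have xij : sym x i j != 0 by rewrite gt_eqF ?sym_gt0.
have -> : 2 = (2 : R)%:C :> R[i] by rewrite rmorph_nat.
by rewrite -!rmorphM -rmorphD -rmorphB; congr (_%:C); rewrite /lam; field.
Qed.

Lemma lc_linear_l x Y : clinear (lc x ^~ Y).
Proof.
move=> a X Z; apply/matrixP => i j; rewrite !mxE /lc_entry mulr_sumr -big_split.
by apply: eq_bigr => k _; rewrite !mxE /=; ring.
Qed.

Lemma lc_linear_r x X : clinear (lc x X).
Proof.
move=> a Y Z; apply/matrixP => i j; rewrite !mxE /lc_entry mulr_sumr -big_split.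
by apply: eq_bigr => k _; rewrite !mxE /=; ring.
Qed.

Lemma lc_in_p x X Y : in_p X -> in_p Y -> in_p (lc x X Y).
Proof.
rewrite !in_pE => -[XH X0] [YH Y0]; split=> [i j|i]; rewrite !mxE /lc_entry.
  rewrite conjc_sum -sumrN; apply: eq_bigr => k _.
  rewrite conjcB !conjcMl !conjcM.
  by rewrite (XH i k) (YH k j) (YH i k) (XH k j); ring.
by apply: big1 => k _; rewrite lam_diag !mul0r subr0.
Qed.

Lemma proj_bracket_in_p X Y : in_p X -> in_p Y -> in_p (proj_p (bracket X Y)).
Proof.
rewrite !in_pE => -[XH X0] [YH Y0]; split=> [i j|i]; rewrite mxE ?eqxx //.
rewrite [in RHS]mxE eq_sym; case: ifP => _; first by rewrite rmorph0 oppr0.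
have B (U V : mat) (k l : 'I_n) : bracket U V k l =
    \sum_m (U k m * V m l - V k m * U m l).
  by rewrite /bracket !mxE -sumrB.
rewrite !B conjc_sum -sumrN; apply: eq_bigr => m _.
by rewrite conjcB !conjcM (XH i m) (YH m j) (YH i m) (XH m j); ring.
Qed.

(** Triple sums and their reindexings, used to bring every term of Koszul's formula to a common
    factor e i j. *)
Let sum3 (F : 'I_n -> 'I_n -> 'I_n -> R[i]) := \sum_i \sum_j \sum_k F i j k.

Let sum3_132 F : sum3 (fun i j k => F i k j) = sum3 F.
Proof. by apply: eq_bigr => i _; rewrite exchange_big. Qed.

Let sum3_213 F : sum3 (fun i j k => F j i k) = sum3 F.
Proof. by rewrite /sum3 exchange_big. Qed.

Let sum3_321 F : sum3 (fun i j k => F k j i) = sum3 F.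
Proof. by rewrite (sum3_132 (fun i j k => F j k i)) sum3_213 sum3_132. Qed.

Let sum3D F G : sum3 (fun i j k => F i j k + G i j k) = sum3 F + sum3 G.
Proof.
rewrite /sum3 -big_split; apply: eq_bigr => i _ /=.
by rewrite -big_split; apply: eq_bigr => j _ /=; rewrite -big_split.
Qed.

Let sum3N F : sum3 (fun i j k => - F i j k) = - sum3 F.
Proof.
rewrite /sum3 -sumrN; apply: eq_bigr => i _.
by rewrite -sumrN; apply: eq_bigr => j _; rewrite -sumrN.
Qed.

Lemma wtr_bracket x X Y Z :
  wtr x (bracket X Y) Z =
  sum3 (fun i j k => (sym x i j)%:C * (X i k * Y k j * Z j i))
  - sum3 (fun i j k => (sym x i j)%:C * (Y i k * X k j * Z j i)).
Proof.
rewrite -sum3N -sum3D; apply: eq_bigr => i _; apply: eq_bigr => j _.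
rewrite /bracket !mxE -sumrB mulr_suml mulr_sumr; apply: eq_bigr => k _.
by ring.
Qed.

(* Koszul's formula: moving e to the right by invariance of the trace, the     *)
(* left-hand side becomes the pairing of e with                                *)
(* x o [X, Y] + [X, x o Y] + [Y, x o X], with o the entrywise product.         *)
Lemma koszul x X Y e : is_metric x -> (forall i, e i i = 0) ->
  wtr x (bracket X Y) e + wtr x (bracket e X) Y + wtr x X (bracket e Y) =
  2 * wtr x (lc x X Y) e.
Proof.
move=> x0 e0; have E1 : wtr x (bracket X Y) e = sum3 (fun i j k =>
    (sym x j i)%:C * (X j k * Y k i * e i j)
    - (sym x j i)%:C * (Y j k * X k i * e i j)).
  by rewrite wtr_bracket -sum3_213 -[X in _ - X]sum3_213 -sum3N -sum3D.
have E2 U V : wtr x (bracket e U) V = sum3 (fun i j k =>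
    (sym x i k)%:C * (e i j * U j k * V k i)
    - (sym x k j)%:C * (U k i * e i j * V j k)).
  by rewrite wtr_bracket -sum3_132 -[X in _ - X]sum3_321 -sum3N -sum3D.
rewrite (wtrC x X) E1 !E2 -!sum3D wtrC mulr_sumr; apply: eq_bigr => i _.
rewrite mulr_sumr; apply: eq_bigr => j _.
rewrite mxE /lc_entry !mulr_sumr; apply: eq_bigr => k _.
have [->|ij] := eqVneq i j; first by rewrite e0 !(mul0r, mulr0); ring.
transitivity (e i j *
    ((2 * (sym x i j)%:C * (lam x j k i)%:C) * (X j k * Y k i)
     - (2 * (sym x i j)%:C * (lam x i k j)%:C) * (Y j k * X k i))); last by ring.
have ji : j != i by rewrite eq_sym.
rewrite (lamE k x0 ij) (symC x i j) (lamE k x0 ji).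
by rewrite (symC x k i) (symC x k j); ring.
Qed.

Lemma coord_basis (k : pair_idx n) b : coord_p (k, b) (basis_p (k, b) : mat) = 1.
Proof.
rewrite /coord_p; move: (basis_pE (R := R) k b (val k).1 (val k).2).
rewrite -surjective_pairing eqxx /=; case: (sval k) => k1 k2 /= ->.
by case: b.
Qed.

Lemma n_gt0 (k : pair_idx n) : (0 < n)%N.
Proof. by case: (val k).1 => m /=; case: (n). Qed.

(** By [koszul] both sides have the same pairing with every basis vector, hence the same
    coordinates. *)
Lemma levi_civitaE x X Y : is_metric x -> in_p X -> in_p Y ->
  levi_civita x X Y = lc x X Y.
Proof.
move=> x0 pX pY; rewrite [RHS]p_basis_expansion; last exact: lc_in_p.
apply: eq_bigr => -[k b] _; congr (_%:C *: _).
set e : mat := basis_p (k, b); have pe : in_p e by exact: basis_p_in_p.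
have -> : tensor x (proj_p (bracket X Y)) e + tensor x (proj_p (bracket e X)) Y
    + tensor x X (proj_p (bracket e Y)) = 2 * tensor x (lc x X Y) e.
  rewrite !tensorE //; try exact: proj_bracket_in_p; last exact: lc_in_p.
  rewrite (wtrC x X) !wtr_projl (wtrC x _ X) -!opprD -!mulrDr -!ReD koszul //.
    by rewrite -[2]/(1 + 1) mulrDl mul1r ReD; ring.
  by case: pe.
rewrite !tensor_basis //; last exact: lc_in_p.
rewrite coord_basis; have /lt0r_neq0 xk := x0 k.
have n0 : (n%:R : R) != 0 by rewrite pnatr_eq0 -lt0n n_gt0.
by rewrite natrM; field; rewrite xk n0.
Qed.

End LeviCivita.

(** * Ricci curvature *)

Section RicciCurvature.
Context {R : realType} {n : nat}.
Local Notation mat := 'M[R[i]]_n.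
Local Notation Re := (@complex.Re R).
Implicit Types (X Y Z W D : mat) (x : tuple_of R n) (i j k l : 'I_n).

Lemma proj_p_linear : clinear (@proj_p R n).
Proof.
move=> a X Y; apply/matrixP => i j; rewrite !mxE.
by case: ifP => _; rewrite ?mulr0 ?addr0.
Qed.

Lemma proj_t_linear : clinear (@proj_t R n).
Proof.
move=> a X Y; apply/matrixP => i j; rewrite !mxE.
by case: ifP => _; rewrite ?mulr0 ?addr0.
Qed.

(** The curvature with [lc] in place of [levi_civita]: it agrees with [curvature] on p, and being
    complex-linear in X it can be traced over the E_ij. *)
Definition lc_curvature x X Y Z : mat :=
  lc x X (lc x Y Z) - lc x Y (lc x X Z) - lc x (proj_p (bracket X Y)) Z
  - bracket (proj_t (bracket X Y)) Z.

Lemma lc_curvature_linear x Y Z : clinear (fun X => lc_curvature x X Y Z).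
Proof.
move=> a X W; rewrite /lc_curvature.
rewrite bracket_linear_l proj_p_linear proj_t_linear bracket_linear_l.
rewrite !(lc_linear_l x) (lc_linear_r x); move: (lc _ _ _) (lc _ _ _).
move=> A1 B1; move: (lc _ _ _) (lc _ _ _) (lc _ _ _) (lc _ _ _).
move=> A2 B2 A3 B3; move: (bracket _ _) (bracket _ _) => A4 B4.
by apply/matrixP => i j; rewrite !mxE; ring.
Qed.

Lemma curvatureE x X Y Z : is_metric x -> in_p X -> in_p Y -> in_p Z ->
  curvature x X Y Z = lc_curvature x X Y Z.
Proof.
move=> x0 pX pY pZ; rewrite /curvature /lc_curvature.
have pXY := proj_bracket_in_p pX pY.
by rewrite !levi_civitaE //; exact: lc_in_p.
Qed.

Lemma lc_delta_l x W i j k l :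
  lc x (delta_mx i j) W k l =
  (k == i)%:R * (lam x k j l)%:C * W j l - (l == j)%:R * (lam x l i k)%:C * W k i.
Proof.
rewrite mxE /lc_entry sumrB; congr (_ - _).
  rewrite (bigD1 j) //= big1 ?addr0 => [|m mj]; rewrite mxE ?eqxx ?andbT.
    by ring.
  by rewrite (negPf mj) andbF mul0r mulr0.
rewrite (bigD1 i) //= big1 ?addr0 => [|m mi]; rewrite mxE ?eqxx ?andTb.
  by ring.
by rewrite (negPf mi) mulr0 mulr0.
Qed.

Lemma bracket_delta_l Y i j k l :
  bracket (delta_mx i j) Y k l = (k == i)%:R * Y j l - Y k i * (j == l)%:R.
Proof.
have entry (A B : mat) : (A - B) k l = A k l - B k l by rewrite !mxE.
by rewrite /bracket entry mul_deltaE delta_mulE.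
Qed.

Lemma bracket_proj_t D Z i j :
  bracket (proj_t D) Z i j = (D i i - D j j) * Z i j.
Proof.
rewrite /bracket !mxE (bigD1 i) //= [in X in _ - X](bigD1 j) //=.
rewrite big1 ?addr0 => [|k ki]; last first.
  by rewrite mxE eq_sym (negPf ki) mul0r.
rewrite big1 ?addr0 => [|k kj]; last first.
  by rewrite mxE (negPf kj) mulr0.
by rewrite !mxE !eqxx; ring.
Qed.

Lemma lc_curvature_delta x Y Z i j : in_p Y -> in_p Z -> i != j ->
  lc_curvature x (delta_mx i j) Y Z i j =
  \sum_k ((lam x i k j * lam x j i k)%:C * (Y i k * Z k i)
          + (lam x j k i * lam x i j k)%:C * (Y k j * Z j k)
          - (k != i)%:R * ((lam x i k j)%:C * (Y j k * Z k j))
          - (k != j)%:R * ((lam x j k i)%:C * (Y k i * Z i k)))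
  - 2 * (Y j i * Z i j).
Proof.
move=> pY pZ ij; have [_ Y0] := pY; have [_ Z0] := pZ.
have entry (A B C D : mat) : (A - B - C - D) i j = A i j - B i j - C i j - D i j.
  by rewrite !mxE.
rewrite /lc_curvature entry {entry}; set E := delta_mx i j : mat.
have [_ V0] := lc_in_p x pY pZ.
(* The term nabla_E (nabla_Y Z) drops out: its entry at (i, j) involves only diagonal entries of
   nabla_Y Z, which lies in p. *)
rewrite lc_delta_l !V0 !mulr0 subrr sub0r bracket_proj_t.
rewrite !bracket_delta_l !eqxx [j == i]eq_sym (negPf ij) !mulr0 !mul0r.
(* The diagonal of [E, Y] is Y j i at i and - Y j i at j, whence the factor 2. *)
rewrite subr0 sub0r mul1r mulr1 opprK -[Y j i + Y j i]mulr2n -[_ *+ 2]mulr_natl.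
rewrite -mulrA; congr (_ - _).
rewrite [lc x Y _ i j]mxE [lc x _ Z i j]mxE /lc_entry -sumrN -sumrB.
apply: eq_bigr => k _; rewrite !lc_delta_l ![proj_p _ _ _]mxE.
rewrite !bracket_delta_l !eqxx Y0 Z0 [i == k]eq_sym [j == k]eq_sym.
rewrite !rmorphM /=.
case: (eqVneq k i) => [ki|ki]; case: (eqVneq k j) => [kj|kj];
  rewrite ?(ki, kj) ?eqxx ?Y0 ?Z0 ?lam_diag /=; ring.
Qed.

End RicciCurvature.

Section RicciFormula.
Context {R : realType} {n : nat}.
Local Notation mat := 'M[R[i]]_n.
Local Notation Re := (@complex.Re R).
Implicit Types (X Y Z W D : mat) (x : tuple_of R n) (i j k l : 'I_n).

Definition ric_coef x i j : R :=
  1 / 2 + (\sum_(l | (l != i) && (l != j))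
    (sym x i j ^+ 2 - sym x i l ^+ 2 - sym x l j ^+ 2)
      / (sym x i l * sym x l j)) / (4 * n)%:R.

Definition ric x : tuple_of R n :=
  [ffun k : pair_idx n => ric_coef x (val k).1 (val k).2].

Lemma sym_ric x i j : i != j -> sym (ric x) i j = ric_coef x i j.
Proof.
apply: (@symP _ _ _ (fun i j r => r = ric_coef x i j)) => k; rewrite ffunE //.
rewrite /ric_coef; congr (_ + _ / _).
under eq_bigl do rewrite andbC.
apply: eq_bigr => l _; rewrite (symC x l) (symC x _ l) (symC x (val k).1).
by rewrite [X in _ / X]mulrC; congr (_ / _); ring.
Qed.

Lemma sum_offdiag_const i j (c : R) : i != j ->
  \sum_(l | (l != i) && (l != j)) c = (n%:R - 2) * c.
Proof.
move=> ij; have : \sum_(l : 'I_n) c = n%:R * c.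
  by rewrite sumr_const card_ord mulr_natl.
rewrite (bigD1 i) //= (bigD1 j) 1?eq_sym //= => H.
by rewrite mulrBl -H; ring.
Qed.

(** Y and Z enter the trace only through the numbers s i k, the real parts of Y i k * Z k i, which
    are symmetric in i and k. Collecting the coefficient of each of them gives a sum over the
    triangles on the edge ik. *)
Lemma RicciE x Y Z : is_metric x -> in_p Y -> in_p Z ->
  Ricci x Y Z = tensor (ric x) Y Z.
Proof.
move=> x0 pY pZ; have [YH0 Y0] := pY; have [ZH0 Z0] := pZ.
have [[YH _] [ZH _]] := (YH0, ZH0).
pose s i k := Re (Y i k * Z k i).
have s_sym i k : s i k = s k i.
  by rewrite /s (YH i k) (ZH k i) mulrNN -conjcM ReJ.
have s_diag i : s i i = 0 by rewrite /s Y0 mul0r.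
pose mu i k j := lam x i k j * lam x j i k - lam x j k i.
pose th i j := 2 * (\sum_k ((lam x i k j * lam x j i k
                    - (k != j)%:R * lam x j k i) * s i k)) - 2 * s i j.
have -> : Ricci x Y Z = \sum_i \sum_(j | j != i) th i j.
  rewrite /Ricci (eq_trace_p (g := fun X => lc_curvature x X Y Z)); last first.
    by move=> a; rewrite curvatureE //; exact: basis_p_in_p.
  rewrite trace_p_clinear; last exact: lc_curvature_linear.
  transitivity (\sum_i \sum_j (if i == j then 0 else th i j)); last first.
    apply: eq_bigr => i _; rewrite [RHS]big_mkcond; apply: eq_bigr => j _.
    by rewrite eq_sym; case: eqP.
  rewrite sum_offdiag => [|i]; last by rewrite eqxx.
  apply: eq_bigr => -[[i j] /= ij] _.
  have nij : i != j by apply/eqP => e; rewrite e ltnn in ij.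
  rewrite [j == i]eq_sym (negPf nij) lc_curvature_delta // ReB Re_sum.
  rewrite /th; have -> : Re (2 * (Y j i * Z i j)) = 2 * s i j.
    by rewrite -[2]/(1 + 1) mulrDl mul1r ReD -/(s j i) s_sym; ring.
  rewrite (s_sym j i).
  have -> : \sum_k Re ((lam x i k j * lam x j i k)%:C * (Y i k * Z k i)
      + (lam x j k i * lam x i j k)%:C * (Y k j * Z j k)
      - (k != i)%:R * ((lam x i k j)%:C * (Y j k * Z k j))
      - (k != j)%:R * ((lam x j k i)%:C * (Y k i * Z i k))) =
    \sum_k ((lam x i k j * lam x j i k - (k != j)%:R * lam x j k i) * s i k)
    + \sum_k ((lam x j k i * lam x i j k - (k != i)%:R * lam x i k j) * s j k).
    rewrite -big_split; apply: eq_bigr => k _ /=.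
    have natC (b : bool) : b%:R = (b%:R : R)%:C :> R[i] by case: b.
    rewrite !natC !ReB ReD !ReMl -/(s i k) -/(s k j) -/(s j k) -/(s k i).
    by rewrite (s_sym k j) (s_sym k i); ring.
  by ring.
(* Exchanging the sums regroups the trace by the factor s i k, the traced index j becoming the third
   vertex of the triangle. *)
have -> : \sum_i \sum_(j | j != i) th i j =
    \sum_i \sum_k s i k *
      (2 * (\sum_(j | (j != i) && (j != k)) mu i k j) - 2).
  apply: eq_bigr => i _; rewrite /th sumrB -mulr_sumr exchange_big /=.
  rewrite -mulr_sumr.
  have -> : \sum_(j | j != i) s i j = \sum_j s i j.
    by rewrite [RHS](bigD1 i) //= s_diag add0r.
  rewrite !mulr_sumr -sumrB; apply: eq_bigr => k _.
  rewrite -mulr_suml; set A := \sum_(j | j != i) _.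
  have [->|ki] := eqVneq k i; first by rewrite s_diag; ring.
  have -> : A = \sum_(j | (j != i) && (j != k)) mu i k j.
    rewrite /A (bigD1 k) //= eqxx lam_diag mulr0 mul0r subr0 add0r.
    by apply: eq_bigr => j /andP[_ jk]; rewrite eq_sym jk mul1r.
  by ring.
rewrite sum_offdiag => [|i]; last by rewrite s_diag mul0r.
rewrite tensorE // /wtr Re_sum (eq_bigr (fun i =>
  \sum_j Re ((sym (ric x) i j)%:C * (Y i j * Z j i)))); last first.
  by move=> i _; rewrite Re_sum.
rewrite sum_offdiag => [|i]; last by rewrite sym_diag mul0r.
rewrite -mulNr mulr_sumr; apply: eq_bigr => -[[i j] /= ij] _.
have nij : i != j by apply/eqP => e; rewrite e ltnn in ij.
rewrite !ReMl -/(s i j) -/(s j i) (s_sym j i) (symC _ j) sym_ric //.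
have n0 : (n%:R : R) != 0.
  by rewrite pnatr_eq0 -lt0n (leq_ltn_trans _ (ltn_ord i)).
have -> : \sum_(k | (k != j) && (k != i)) mu j i k =
    \sum_(k | (k != i) && (k != j)) mu j i k.
  by apply: eq_bigl => k; rewrite andbC.
pose q l := (sym x i j ^+ 2 - sym x i l ^+ 2 - sym x l j ^+ 2)
   / (sym x i l * sym x l j).
(* Each triangle contributes - q l / 2 - 1. The n - 2 constants combine with the torus terms to give
   the summand 1/2 of [ric_coef]. *)
have E : \sum_(l | (l != i) && (l != j)) mu i j l
       + \sum_(l | (l != i) && (l != j)) mu j i l =
    - (\sum_(l | (l != i) && (l != j)) q l) / 2
    - \sum_(l | (l != i) && (l != j)) 1.
  rewrite -big_split -sumrN mulr_suml -sumrB; apply: eq_bigr => l /andP[li lj].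
  rewrite /q /mu /lam (symC x l i) (symC x j i) (symC x j l).
  have xil : sym x i l != 0 by rewrite gt_eqF ?sym_gt0 // eq_sym.
  have xlj : sym x l j != 0 by rewrite gt_eqF ?sym_gt0.
  by rewrite /=; field; rewrite xil xlj.
rewrite sum_offdiag_const // in E.
have -> : ric_coef x i j =
    1 / 2 + (\sum_(l | (l != i) && (l != j)) q l) / (4 * n)%:R by [].
move: E; set A := \sum_(l | _) mu i j l; set B := \sum_(l | _) mu j i l.
set Q := \sum_(l | _) q l => E; have -> : A = A + B - B by rewrite addrK.
by rewrite E natrM; field.
Qed.

End RicciFormula.

(** * Hessian of the scalar curvature *)

Section ExponentialSums.
Context {R : realType}.
Implicit Types (F G : R -> R -> R) (r : seq (R * R * R)).

(* F is a sum of terms c exp(s a + t b), and d is its mixed derivative at 0. *)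
Definition expsum F (d : R) : Prop :=
  exists r : seq (R * R * R),
    (forall s t, F s t =
       \sum_(m <- r) m.1.1 * expR (s * m.1.2 + t * m.2)) /\
    d = \sum_(m <- r) m.1.1 * m.1.2 * m.2.

Lemma expsum1 (c a b : R) :
  expsum (fun s t => c * expR (s * a + t * b)) (c * a * b).
Proof.
by exists [:: (c, a, b)]; split=> [s t|]; rewrite big_seq1.
Qed.

Lemma eq_expsum F G d e : (forall s t, F s t = G s t) -> d = e ->
  expsum G e -> expsum F d.
Proof. by move=> FG -> [r [rG ->]]; exists r; split=> // s t; rewrite FG. Qed.

Lemma expsumD F G d e : expsum F d -> expsum G e ->
  expsum (fun s t => F s t + G s t) (d + e).
Proof.
move=> [r [rF ->]] [r' [rG ->]]; exists (r ++ r'); rewrite big_cat /=.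
by split=> // s t; rewrite big_cat rF rG.
Qed.

Lemma expsumZ c F d : expsum F d -> expsum (fun s t => c * F s t) (c * d).
Proof.
move=> [r [rF ->]]; exists [seq (c * m.1.1, m.1.2, m.2) | m <- r].
rewrite big_map mulr_sumr; split=> [s t|].
  by rewrite rF big_map mulr_sumr; apply: eq_bigr => m _; rewrite mulrA.
by apply: eq_bigr => m _ /=; rewrite !mulrA.
Qed.

Lemma expsum_sum (I : Type) (q : seq I) (P : pred I) (F : I -> R -> R -> R)
    (d : I -> R) :
  (forall i, P i -> expsum (F i) (d i)) ->
  expsum (fun s t => \sum_(i <- q | P i) F i s t) (\sum_(i <- q | P i) d i).
Proof.
move=> Fd; elim: q => [|i q IH].
  by exists [::]; split=> [s t|]; rewrite !big_nil.
case Pi : (P i); last first.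
  by apply: eq_expsum IH => [s t|]; rewrite big_cons Pi.
apply: eq_expsum (expsumD (Fd i Pi) IH) => [s t|]; by rewrite big_cons Pi.
Qed.

Lemma is_derive_expR_affine (c a b t : R) :
  is_derive t 1 (fun t : R => c * expR (a + t * b)) (c * b * expR (a + t * b)).
Proof.
apply: is_derive_eq.
by rewrite /GRing.scale /=; ring.
Qed.

Lemma is_derive_expsum r (a : R * R * R -> R) (t : R) :
  is_derive t 1 (fun t : R => \sum_(m <- r) m.1.1 * expR (a m + t * m.2))
    (\sum_(m <- r) m.1.1 * m.2 * expR (a m + t * m.2)).
Proof.
elim: r => [|m r IH].
  rewrite big_nil (_ : (fun _ => _) = cst 0); last first.
    by apply/funext => s; rewrite big_nil.
  exact: is_derive_cst.
rewrite big_cons (_ : (fun _ => _) = (fun t => m.1.1 * expR (a m + t * m.2)) \+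
    (fun t => \sum_(m <- r) m.1.1 * expR (a m + t * m.2))); last first.
  by apply/funext => s; rewrite big_cons.
exact: is_deriveD (is_derive_expR_affine _ _ _ _) IH.
Qed.

Lemma expsum_derive F d : expsum F d ->
  derive1 (fun s : R => derive1 (fun t : R => F s t) 0) 0 = d.
Proof.
move=> [r [rF ->]].
have -> : (fun s : R => derive1 (fun t : R => F s t) 0) =
    (fun s => \sum_(m <- r) m.1.1 * m.2 * expR (s * m.1.2)).
  apply/funext => s.
  have -> : F s = (fun t => \sum_(m <- r) m.1.1 * expR (s * m.1.2 + t * m.2)).
    exact/funext/rF.
  rewrite derive1E (@derive_val _ _ _ _ _ _ _
    (is_derive_expsum r (fun m => s * m.1.2) 0)).
  by apply: eq_bigr => m _; rewrite mul0r addr0.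
(* The inner derivative at t = 0 is again a sum of exponentials, so [is_derive_expsum] applies a
   second time, with constant parts 0. *)
pose r' := [seq (m.1.1 * m.2, 0 : R, m.1.2) | m <- r].
have -> : (fun s => \sum_(m <- r) m.1.1 * m.2 * expR (s * m.1.2)) =
    (fun s => \sum_(m <- r') m.1.1 * expR (0 + s * m.2)).
  apply/funext => s; rewrite big_map; apply: eq_bigr => m _ /=.
  by rewrite add0r.
rewrite derive1E (@derive_val _ _ _ _ _ _ _ (is_derive_expsum r' (fun=> 0) 0)).
rewrite big_map; apply: eq_bigr => m _ /=.
by rewrite mul0r addr0 expR0; ring.
Qed.

End ExponentialSums.

Section Hessian.
Context {R : realType} {n : nat}.
Implicit Types (v w x : tuple_of R n) (p q : 'I_n -> 'I_n -> R).

Lemma metric_trace_tensor x v : is_metric x ->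
  metric_trace x (tensor v) = 2 * \sum_k v k / x k.
Proof.
move=> x0; pose F (k : pair_idx n) (b : bool) := v k / x k.
rewrite /metric_trace (eq_bigr (fun a => F a.1 a.2)) => [|[k b] _].
  rewrite -(pair_bigA _ F) /= mulr_sumr; apply: eq_bigr => k _.
  by rewrite big_bool /F /=; ring.
rewrite !tensor_basis; try exact: basis_p_in_p.
rewrite coord_basis /F /=; have /lt0r_neq0 xk := x0 k.
have n0 : (n%:R : R) != 0 by rewrite pnatr_eq0 -lt0n (n_gt0 k).
by rewrite natrM; field; rewrite xk n0.
Qed.

Lemma scalar_curvatureE x : is_metric x ->
  scalar_curvature x = 2 * \sum_k ric x k / x k.
Proof.
move=> x0; rewrite -metric_trace_tensor //; apply: eq_bigr => a _.
by rewrite RicciE //; exact: basis_p_in_p.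
Qed.

Lemma chart_metric x v : is_metric x -> is_metric (chart x v).
Proof. by move=> x0 k; rewrite ffunE mulr_gt0 ?expR_gt0. Qed.

Definition ratio x v (i j : 'I_n) : R := sym v i j / sym x i j.

Lemma sym_chart x v i j :
  sym (chart x v) i j = sym x i j * expR (ratio x v i j).
Proof.
have [->|ij] := eqVneq i j; first by rewrite !sym_diag mul0r.
apply: (@symP _ _ _ (fun i j r => r = sym x i j * expR (ratio x v i j))) => // k.
  by rewrite ffunE /ratio !sym_val.
by rewrite ffunE /ratio !(symC _ (val k).2) !sym_val.
Qed.

(** The weight of a triangle with marked edge ij. Moving in the chart multiplies it by the
    exponential of the [excess] of the relative variation. *)
Definition tri x (i j l : 'I_n) : R := sym x i j / (sym x i l * sym x j l).

Definition excess p (i j l : 'I_n) : R := p i j - p i l - p j l.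

(** Dividing the Ricci coefficient of an edge by its metric value splits every summand into three
    marked triangles. Each triangle is visited from its three edges and the terms are left
    uncollected; a marked triangle has total coefficient -1/(2n). *)
Lemma scalar_curvature_sum x : is_metric x ->
  scalar_curvature x = \sum_(k : pair_idx n)
    (1 / sym x (val k).1 (val k).2
     + (2 * n)%:R^-1 * \sum_(l | (l != (val k).1) && (l != (val k).2))
        (tri x (val k).1 (val k).2 l
         - tri x (val k).1 l (val k).2 - tri x (val k).2 l (val k).1)).
Proof.
move=> x0; rewrite scalar_curvatureE // mulr_sumr; apply: eq_bigr => k _.
rewrite ffunE -(sym_val x k); have := valP k.
move: (val k).1 (val k).2 => i j ij.
have nij : i != j by apply/eqP => e; rewrite e ltnn in ij.
have xij : sym x i j != 0 by rewrite gt_eqF ?sym_gt0.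
have n0 : (n%:R : R) != 0.
  by rewrite pnatr_eq0 -lt0n (leq_ltn_trans _ (ltn_ord i)).
rewrite /ric_coef; set S := \sum_(l | _) _; set S' := \sum_(l | _) _.
have -> : S = sym x i j * S'.
  rewrite /S /S' mulr_sumr; apply: eq_bigr => l /andP[li lj].
  rewrite /tri (symC x l j) (symC x j i).
  have xil : sym x i l != 0 by rewrite gt_eqF ?sym_gt0 // eq_sym.
  have xjl : sym x j l != 0 by rewrite gt_eqF ?sym_gt0 // eq_sym.
  by rewrite (symC x l i); field; rewrite xij xil xjl.
by rewrite !natrM; field; rewrite xij n0.
Qed.

(* p and q stand for the relative variations v / x and w / x. *)
Definition hess x p q : R :=
  \sum_(k : pair_idx n)
    (p (val k).1 (val k).2 * q (val k).1 (val k).2 / sym x (val k).1 (val k).2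
     + (2 * n)%:R^-1 * \sum_(l | (l != (val k).1) && (l != (val k).2))
        (tri x (val k).1 (val k).2 l
           * excess p (val k).1 (val k).2 l * excess q (val k).1 (val k).2 l
         - tri x (val k).1 l (val k).2
           * excess p (val k).1 l (val k).2 * excess q (val k).1 l (val k).2
         - tri x (val k).2 l (val k).1
           * excess p (val k).2 l (val k).1 * excess q (val k).2 l (val k).1)).

Lemma ratio_lin x v w s t i j :
  ratio x (s *: v + t *: w) i j = s * ratio x v i j + t * ratio x w i j.
Proof.
rewrite /ratio; have [->|ij] := eqVneq i j; first by rewrite !sym_diag; ring.
have -> : sym (s *: v + t *: w) i j = s * sym v i j + t * sym w i j.
  apply: (@symP _ _ _ (fun i j r => r = s * sym v i j + t * sym w i j)) => // k.
    by rewrite !ffunE !sym_val.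
  by rewrite !ffunE !(symC _ (val k).2) !sym_val.
by ring.
Qed.

(** In the chart every entry of the metric is multiplied by the exponential of a linear form, so
    each summand of [scalar_curvature_sum] is a single exponential and its mixed derivative is the
    product of the two slopes. *)
Lemma Sc_hessianE x v w : is_metric x ->
  Sc_hessian x v w = hess x (ratio x v) (ratio x w).
Proof.
move=> x0; apply: expsum_derive.
pose y s t := chart x (s *: v + t *: w).
have symy s t i j : sym (y s t) i j =
    sym x i j * expR (s * ratio x v i j + t * ratio x w i j).
  by rewrite sym_chart ratio_lin.
have triE i j l : expsum (fun s t => tri (y s t) i j l)
   (tri x i j l * excess (ratio x v) i j l * excess (ratio x w) i j l).
  apply: eq_expsum (expsum1 _ _ _) => // s t.
  rewrite /tri !symy /excess.
  have -> : s * (ratio x v i j - ratio x v i l - ratio x v j l) +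
     t * (ratio x w i j - ratio x w i l - ratio x w j l) =
     (s * ratio x v i j + t * ratio x w i j)
     - (s * ratio x v i l + t * ratio x w i l)
     - (s * ratio x v j l + t * ratio x w j l) by ring.
  by rewrite !(expRN, expRD) !invfM; ring.
apply: (eq_expsum (fun s t => scalar_curvature_sum
  (chart_metric (s *: v + t *: w) x0)) erefl).
apply: expsum_sum => k _; apply: expsumD.
  apply: eq_expsum (expsum1 (1 / sym x (val k).1 (val k).2)
    (- ratio x v (val k).1 (val k).2) (- ratio x w (val k).1 (val k).2)).
    move=> s t; rewrite symy !mulrN -opprD expRN invfM.
    by rewrite !mul1r.
  by ring.
apply: expsumZ; apply: expsum_sum => l _.
have N F (d : R) : expsum F d -> expsum (fun s t => - F s t) (- d).
  move=> Fd; apply: eq_expsum (expsumZ (-1) Fd) => [s t|]; by rewrite mulN1r.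
by apply: expsumD; [apply: expsumD|]; [|apply: N|apply: N]; exact: triE.
Qed.

Lemma TT_E x v : is_metric x -> TT x v <-> \sum_k v k / x k = 0.
Proof.
move=> x0; rewrite /TT metric_trace_tensor //; split=> [|->]; last by rewrite mulr0.
by move/eqP; rewrite mulf_eq0 pnatr_eq0 /= => /eqP.
Qed.

Lemma sym_scale r x i j : sym (r *: x) i j = r * sym x i j.
Proof.
have [->|ij] := eqVneq i j; first by rewrite !sym_diag mulr0.
apply: (@symP _ _ _ (fun i j s => s = r * sym x i j)) => // k.
  by rewrite !ffunE !sym_val.
by rewrite !ffunE !(symC _ (val k).2) !sym_val.
Qed.

(** Handles the unit-volume rescaling: signs, and hence the signature, are unchanged for r > 0. *)
Lemma hess_scale r x p q : r != 0 -> hess (r *: x) p q = r^-1 * hess x p q.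
Proof.
move=> r0; have tr i j l : tri (r *: x) i j l = r^-1 * tri x i j l.
  rewrite /tri !sym_scale !invfM.
  by rewrite -[r^-1 in RHS]mulr1 -(mulfV r0); ring.
rewrite /hess mulr_sumr; apply: eq_bigr => k _.
rewrite sym_scale mulrDr !invfM; congr (_ + _); first by ring.
rewrite [RHS]mulrCA; congr (_ * _); rewrite mulr_sumr; apply: eq_bigr => l _.
by rewrite !tr; ring.
Qed.

End Hessian.

(** * Signature from a splitting into definite subspaces *)

Section Signature.
Context {R : realType} {n : nat}.
Implicit Types (v w x : tuple_of R n) (p q : 'I_n -> 'I_n -> R).

Lemma hessC x p q : hess x p q = hess x q p.
Proof.
apply: eq_bigr => k _; congr (_ / _ + _ * _); first exact: mulrC.
by apply: eq_bigr => l _; ring.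
Qed.

Lemma hess_linear_l x p p1 p2 q (a b : R) :
  (forall i j, p i j = a * p1 i j + b * p2 i j) ->
  hess x p q = a * hess x p1 q + b * hess x p2 q.
Proof.
move=> E; rewrite /hess !mulr_sumr -big_split; apply: eq_bigr => k _ /=.
set S := \sum_(l | _) _; set S1 := \sum_(l | _) _; set S2 := \sum_(l | _) _.
have -> : S = a * S1 + b * S2.
  rewrite /S /S1 /S2 !mulr_sumr -big_split; apply: eq_bigr => l _ /=.
  by rewrite /excess !E; ring.
by rewrite E; ring.
Qed.

Lemma Sc_hessian_sym x v w : is_metric x -> Sc_hessian x v w = Sc_hessian x w v.
Proof. by move=> x0; rewrite !Sc_hessianE // hessC. Qed.

Lemma Sc_hessian_linear x (a b : R) v w u : is_metric x ->
  Sc_hessian x (a *: v + b *: w) u =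
  a * Sc_hessian x v u + b * Sc_hessian x w u.
Proof.
move=> x0; rewrite !Sc_hessianE //; apply: hess_linear_l => i j.
exact: ratio_lin.
Qed.

Lemma TT_linear x (a b : R) v w : is_metric x -> TT x v -> TT x w ->
  TT x (a *: v + b *: w).
Proof.
move=> x0; rewrite !TT_E // => v0 w0.
under eq_bigr => k _ do rewrite !ffunE mulrDl -!mulrA.
by rewrite big_split /= -!mulr_sumr v0 w0 !mulr0 addr0.
Qed.

Section Split.
Variables (d : nat) (x : tuple_of R n).
Variables (iota : {linear 'rV[R]_d -> tuple_of R n}).
Variables (phi : {linear tuple_of R n -> 'rV[R]_d}).
Hypothesis x0 : is_metric x.
Hypothesis iotaK : cancel iota phi.
Hypothesis TT_iota : forall t, TT x (iota t).
Hypothesis pos : forall t, t != 0 -> 0 < Sc_hessian x (iota t) (iota t).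
Hypothesis neg : forall v, TT x v -> phi v = 0 -> v != 0 ->
  Sc_hessian x v v < 0.

(** Write v = p + m with p in the image of [iota] and m in the kernel of [phi]. Testing v against p
    - m cancels the cross terms and gives H(p, p) = H(m, m); the signs force p = 0, and then H(v, v)
    = 0 forces v = 0. *)
Lemma split_nondegenerate : nondegenerate x.
Proof.
move=> v vT vH; pose p := iota (phi v); pose m := v - p.
have mE : m = 1 *: v + (-1) *: p by rewrite scale1r scaleN1r.
have mT : TT x m by rewrite mE; apply: TT_linear => //; exact: TT_iota.
have m0 : phi m = 0 by rewrite /m linearB iotaK subrr.
have Hm : Sc_hessian x m m <= 0.
  have [->|nm] := eqVneq m 0; last by rewrite ltW // neg.
  by rewrite -[X in Sc_hessian _ X _](scale0r v) -[_ *: v]addr0 -(scale0r v)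
    Sc_hessian_linear // !mul0r addr0.
have E : Sc_hessian x p p = Sc_hessian x m m.
  have : Sc_hessian x (1 *: p + 1 *: m) (1 *: p + (-1) *: m) = 0.
    rewrite !scale1r /m addrC subrK; apply: vH.
    rewrite scaleN1r -/m -[p]scale1r -scaleN1r.
    by apply: TT_linear => //; exact: TT_iota.
  have H2 u : Sc_hessian x u (1 *: p + (-1) *: m) =
      1 * Sc_hessian x u p + (-1) * Sc_hessian x u m.
    by rewrite !(Sc_hessian_sym u) // (Sc_hessian_linear 1 (-1) p m u x0).
  rewrite (Sc_hessian_linear 1 1 p m _ x0) !H2 (Sc_hessian_sym p m x0).
  move: (Sc_hessian x p p) (Sc_hessian x m p) (Sc_hessian x m m) => A B C H.
  by apply/eqP; rewrite -subr_eq0 -H; apply/eqP; ring.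
have [v0|v0] := eqVneq (phi v) 0; last first.
  by have := pos v0; rewrite -/p E ltNge Hm.
apply/eqP/negPn/negP => /(neg vT v0).
by rewrite (vH v vT) ltxx.
Qed.

Lemma split_unstable : (0 < d)%N -> unstable x.
Proof.
move=> d0; exists (iota (const_mx 1)); split; first exact: TT_iota.
apply: pos; apply/eqP => /matrixP/(_ 0 (Ordinal d0)) /eqP.
by rewrite !mxE oner_eq0.
Qed.

(** The image of [iota] realizes d. Conversely a positive subspace meets the kernel of [phi], where
    the form is negative, only in 0, so [phi] embeds it into a space of dimension d. *)
Lemma split_coindex : coindex x d.
Proof.
have dim_rV : \dim {: 'rV[R]_d} = d by rewrite dimvf; exact: mul1n.
split.
  exists (limg (linfun iota)); split; first split.
  - by move=> v /memv_imgP[t _ ->]; rewrite lfunE; exact: TT_iota.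
  - move=> v /memv_imgP[t _ ->]; rewrite lfunE => t0; apply: pos.
    by apply: contraNneq t0 => ->; rewrite linear0.
  rewrite limg_dim_eq ?dim_rV //; apply/eqP; rewrite -subv0; apply/subvP => t.
  rewrite memv_cap memv_ker lfunE memv0 => /andP[_ /eqP t0].
  by rewrite -(iotaK t) t0 linear0.
move=> U [UT Upos]; rewrite -(limg_ker_dim (linfun phi) U).
have -> : (U :&: lker (linfun phi))%VS = 0%VS.
  apply/eqP; rewrite -subv0; apply/subvP => v.
  rewrite memv_cap memv_ker lfunE memv0 => /andP[vU /eqP v0].
  apply/negPn/negP => nv; have := Upos v vU nv.
  by rewrite ltNge ltW // neg //; exact: UT.
rewrite dimv0 add0n; apply: leq_trans (dimvS (subvf _)) _.
by rewrite dim_rV.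
Qed.

End Split.
End Signature.

(** * The algebraic numbers c, M, N, L *)

Section AlgebraicNumbers.
Context {F : realFieldType}.
Implicit Types c : F.

Definition polyP c : F :=
  17500%:R * c ^+ 6 - 113750%:R * c ^+ 5 + 316325%:R * c ^+ 4
  - 490500%:R * c ^+ 3 + 447800%:R * c ^+ 2 - 225550%:R * c + 48503%:R.

Definition valM c : F :=
  8971375%:R / 1666862%:R * c ^+ 5 - 98032375%:R / 3333724%:R * c ^+ 4
  + 446084445%:R / 6667448%:R * c ^+ 3 - 68439950%:R / 833431%:R * c ^+ 2
  + 357123741%:R / 6667448%:R * c - 109792137%:R / 8334310%:R.

Definition valN c : F :=
  268587215%:R / 13334896%:R - 930186785%:R / 13334896%:R * c
  + 1387293825%:R / 13334896%:R * c ^+ 2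
  - 1110422865%:R / 13334896%:R * c ^+ 3
  + 239341375%:R / 6667448%:R * c ^+ 4 - 21499625%:R / 3333724%:R * c ^+ 5.

Definition valL c : F :=
  10670625%:R / 3333724%:R * c ^+ 5 - 129829875%:R / 6667448%:R * c ^+ 4
  + 654761925%:R / 13334896%:R * c ^+ 3
  - 876763875%:R / 13334896%:R * c ^+ 2
  + 627815565%:R / 13334896%:R * c - 183414881%:R / 13334896%:R.

(** The least common multiple of the denominators written in M, N, L. The numerators [intM], [intN],
    [intL], [intH] have integer coefficients, so that the identities modulo P can be checked without
    fractions. *)
Definition common_denom : F := 66674480%:R.

Definition intM c : F :=
  358855000%:R * c ^+ 5 - 1960647500%:R * c ^+ 4 + 4460844450%:R * c ^+ 3
  - 5475196000%:R * c ^+ 2 + 3571237410%:R * c - 878337096%:R.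

Definition intN c : F :=
  - 429992500%:R * c ^+ 5 + 2393413750%:R * c ^+ 4 - 5552114325%:R * c ^+ 3
  + 6936469125%:R * c ^+ 2 - 4650933925%:R * c + 1342936075%:R.

Definition intL c : F :=
  213412500%:R * c ^+ 5 - 1298298750%:R * c ^+ 4 + 3273809625%:R * c ^+ 3
  - 4383819375%:R * c ^+ 2 + 3139077825%:R * c - 917074405%:R.

Definition intH c : F := 33337240%:R * c.

Lemma common_denom_neq0 : common_denom != 0.
Proof. by apply: lt0r_neq0; rewrite /common_denom; lra. Qed.

Lemma valME c : valM c = intM c / common_denom.
Proof. by rewrite /valM /intM /common_denom; lra. Qed.

Lemma valNE c : valN c = intN c / common_denom.
Proof. by rewrite /valN /intN /common_denom; lra. Qed.

Lemma valLE c : valL c = intL c / common_denom.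
Proof. by rewrite /valL /intL /common_denom; lra. Qed.

Lemma halfE c : c / 2 = intH c / common_denom.
Proof. by rewrite /intH /common_denom; lra. Qed.

(* The cofactors of polyP c below are quotients of polynomial divisions. *)
Lemma int_einstein12 c (M := intM c) (N := intN c) (h := intH c) :
  polyP c = 0 ->
  common_denom * (5 * (h * N) ^+ 2 + M ^+ 2 * (N ^+ 2 + h ^+ 2))
  - 10 * M * (h * N) ^+ 2 = 0.
Proof.
move=> Pc; transitivity (polyP c *
    (90715469634524829233156885000000000000%:R * c ^+ 14
     - 1411495691358654581611303767500000000000%:R * c ^+ 13
     + 10337214532658547627649373878200000000000%:R * c ^+ 12
     - 47414328429945496091741953399675000000000%:R * c ^+ 11
     + 152503202857307630024066846287448000000000%:R * c ^+ 10
     - 364181103150166831526765028969562750000000%:R * c ^+ 9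
     + 665891077001085234498603412348496915000000%:R * c ^+ 8
     - 946570792701321007822161503021014960000000%:R * c ^+ 7
     + 1050193796254467701047671453162755459000000%:R * c ^+ 6
     - 903715765800405062346524798603282960400000%:R * c ^+ 5
     + 592595917068933273451643372467246840200000%:R * c ^+ 4
     - 286361981937064635483215196351436470720000%:R * c ^+ 3
     + 96038381014736811033817746129135896456000%:R * c ^+ 2
     - 19906538452316529312146912818644571200000%:R * c
     + 1912600069331290923924726647586998400000%:R)); last by rewrite Pc mul0r.
by rewrite /M /N /h /common_denom /polyP /intM /intN /intH; ring.
Qed.

Lemma int_einstein14 c (M := intM c) (N := intN c) (L := intL c) (h := intH c) :
  polyP c = 0 ->
  common_denom *
    (10 * (h * N * L) - 2 * (M * N * L) + h * (h ^+ 2 - N ^+ 2 - L ^+ 2))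
  - 10 * h * (h * N * L) = 0.
Proof.
move=> Pc; transitivity (polyP c *
    (250929268127179135830000000000%:R * c ^+ 9
     - 2663191067197140926754000000000%:R * c ^+ 8
     + 12830604963441684540720900000000%:R * c ^+ 7
     - 37034113842583618594475460000000%:R * c ^+ 6
     + 70771224455416123605443947000000%:R * c ^+ 5
     - 92942048737302295270301800000000%:R * c ^+ 4
     + 83911018678370587297509167760000%:R * c ^+ 3
     - 50211912074144926199319100800000%:R * c ^+ 2
     + 18056213214324008267072625720000%:R * c
     - 2974008256840085568728682720000%:R)); last by rewrite Pc mul0r.
by rewrite /M /N /L /h /common_denom /polyP /intM /intN /intL /intH; ring.
Qed.

Lemma int_einstein15 c (M := intM c) (N := intN c) (L := intL c) (h := intH c) :
  polyP c = 0 ->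
  common_denom *
    (10 * (h * N * L) - 2 * (M * h * L) + N * (N ^+ 2 - h ^+ 2 - L ^+ 2))
  - 10 * N * (h * N * L) = 0.
Proof.
move=> Pc; transitivity (polyP c *
    (- 751680367593986948512500000000%:R * c ^+ 10
     + 7826619195616971262093000000000%:R * c ^+ 9
     - 36942981218291683004719375000000%:R * c ^+ 8
     + 104386300803198968482810490000000%:R * c ^+ 7
     - 195033186403002966281213286250000%:R * c ^+ 6
     + 249311199972151385621710527050000%:R * c ^+ 5
     - 216135946895947392843904101500000%:R * c ^+ 4
     + 119357825580321504011058730900000%:R * c ^+ 3
     - 34202378074528181438085187050000%:R * c ^+ 2
     + 406624528766508275532759866000%:R * c
     + 1776746146272877454043595200000%:R)); last by rewrite Pc mul0r.
by rewrite /M /N /L /h /common_denom /polyP /intM /intN /intL /intH; ring.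
Qed.

Lemma int_einstein45 c (N := intN c) (L := intL c) (h := intH c) :
  polyP c = 0 ->
  common_denom * (10 * (h * N) + 3 * (L ^+ 2 - h ^+ 2 - N ^+ 2))
  - 10 * L * (h * N) = 0.
Proof.
move=> Pc; transitivity (polyP c *
    (1748124368666865000000%:R * c ^+ 5
     - 10595047241271857700000%:R * c ^+ 4
     + 25309524077490048150000%:R * c ^+ 3
     - 30483268820031471948000%:R * c ^+ 2 + 18394877084529827790000%:R * c
     - 3969093196650207168000%:R)); last by rewrite Pc mul0r.
by rewrite /N /L /h /common_denom /polyP /intN /intL /intH; ring.
Qed.

(** The two sides of each Einstein equation are homogeneous of degrees differing by one, so one
    factor of the common denominator remains when the numerators are substituted. *)
Section Homogeneity.
Variables d m n l k M N L h : F.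
Hypothesis d0 : d != 0.
Hypotheses (ME : M = m / d) (NE : N = n / d) (LE : L = l / d) (hE : h = k / d).

Lemma homogeneous_einstein12 :
  d * (5 * (k * n) ^+ 2 + m ^+ 2 * (n ^+ 2 + k ^+ 2))
  - 10 * m * (k * n) ^+ 2 = 0 ->
  5 * (h * N) ^+ 2 + M ^+ 2 * (N ^+ 2 + h ^+ 2) =
  10 * M * (h * N) ^+ 2.
Proof.
move=> E; apply/eqP; rewrite -subr_eq0; apply/eqP.
by rewrite -[RHS](mul0r (d ^- 5)) -E ME NE hE; field.
Qed.

Lemma homogeneous_einstein14 :
  d * (10 * (k * n * l) - 2 * (m * n * l) + k * (k ^+ 2 - n ^+ 2 - l ^+ 2))
  - 10 * k * (k * n * l) = 0 ->
  10 * (h * N * L) - 2 * (M * N * L) + h * (h ^+ 2 - N ^+ 2 - L ^+ 2) =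
  10 * h * (h * N * L).
Proof.
move=> E; apply/eqP; rewrite -subr_eq0; apply/eqP.
by rewrite -[RHS](mul0r (d ^- 4)) -E ME NE LE hE; field.
Qed.

Lemma homogeneous_einstein15 :
  d * (10 * (k * n * l) - 2 * (m * k * l) + n * (n ^+ 2 - k ^+ 2 - l ^+ 2))
  - 10 * n * (k * n * l) = 0 ->
  10 * (h * N * L) - 2 * (M * h * L) + N * (N ^+ 2 - h ^+ 2 - L ^+ 2) =
  10 * N * (h * N * L).
Proof.
move=> E; apply/eqP; rewrite -subr_eq0; apply/eqP.
by rewrite -[RHS](mul0r (d ^- 4)) -E ME NE LE hE; field.
Qed.

Lemma homogeneous_einstein45 :
  d * (10 * (k * n) + 3 * (l ^+ 2 - k ^+ 2 - n ^+ 2))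
  - 10 * l * (k * n) = 0 ->
  10 * (h * N) + 3 * (L ^+ 2 - h ^+ 2 - N ^+ 2) =
  10 * L * (h * N).
Proof.
move=> E; apply/eqP; rewrite -subr_eq0; apply/eqP.
by rewrite -[RHS](mul0r (d ^- 3)) -E NE LE hE; field.
Qed.

End Homogeneity.

Lemma einstein12 c (M := valM c) (N := valN c) (h := c / 2) :
  polyP c = 0 ->
  5 * (h * N) ^+ 2 + M ^+ 2 * (N ^+ 2 + h ^+ 2) =
  10 * M * (h * N) ^+ 2.
Proof.
move=> Pc; exact: (homogeneous_einstein12 common_denom_neq0
  (valME c) (valNE c) (halfE c) (int_einstein12 Pc)).
Qed.

Lemma einstein14 c (M := valM c) (N := valN c) (L := valL c) (h := c / 2) :
  polyP c = 0 ->
  10 * (h * N * L) - 2 * (M * N * L) + h * (h ^+ 2 - N ^+ 2 - L ^+ 2) =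
  10 * h * (h * N * L).
Proof.
move=> Pc; exact: (homogeneous_einstein14 common_denom_neq0
  (valME c) (valNE c) (valLE c) (halfE c) (int_einstein14 Pc)).
Qed.

Lemma einstein15 c (M := valM c) (N := valN c) (L := valL c) (h := c / 2) :
  polyP c = 0 ->
  10 * (h * N * L) - 2 * (M * h * L) + N * (N ^+ 2 - h ^+ 2 - L ^+ 2) =
  10 * N * (h * N * L).
Proof.
move=> Pc; exact: (homogeneous_einstein15 common_denom_neq0
  (valME c) (valNE c) (valLE c) (halfE c) (int_einstein15 Pc)).
Qed.

Lemma einstein45 c (N := valN c) (L := valL c) (h := c / 2) :
  polyP c = 0 ->
  10 * (h * N) + 3 * (L ^+ 2 - h ^+ 2 - N ^+ 2) =
  10 * L * (h * N).
Proof.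
move=> Pc; exact: (homogeneous_einstein45 common_denom_neq0
  (valNE c) (valLE c) (halfE c) (int_einstein45 Pc)).
Qed.

End AlgebraicNumbers.

(** * Isolation of the two real roots of P *)

Section Roots.
Context {F : rcfType}.
Implicit Types x : F.

Definition dpolyP x : F :=
  105000%:R * x ^+ 5 - 568750%:R * x ^+ 4 + 1265300%:R * x ^+ 3
  - 1471500%:R * x ^+ 2 + 895600%:R * x - 225550%:R.

Definition poly7 (a0 a1 a2 a3 a4 a5 a6 : F) : {poly F} :=
  a6 *: 'X^6 + a5 *: 'X^5 + a4 *: 'X^4 + a3 *: 'X^3 + a2 *: 'X^2 + a1 *: 'X
  + a0%:P.

(* Stated for variable coefficients, because the rewriting rules of the proof  *)
(* would convert numerals to unary form.                                       *)
Lemma horner_poly7 (a0 a1 a2 a3 a4 a5 a6 x : F) :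
  (poly7 a0 a1 a2 a3 a4 a5 a6).[x] =
    a6 * x ^+ 6 + a5 * x ^+ 5 + a4 * x ^+ 4 + a3 * x ^+ 3
    + a2 * x ^+ 2 + a1 * x + a0 /\
  (deriv (poly7 a0 a1 a2 a3 a4 a5 a6)).[x] =
    a6 * 6 * x ^+ 5 + a5 * 5 * x ^+ 4 + a4 * 4 * x ^+ 3
    + a3 * 3 * x ^+ 2 + a2 * 2 * x + a1.
Proof.
by rewrite /poly7; split; rewrite ?poly.derivE !hornerE //=; ring.
Qed.

Definition poly_of_P : {poly F} :=
  poly7 48503%:R (- 225550%:R) 447800%:R (- 490500%:R) 316325%:R
    (- 113750%:R) 17500%:R.

Lemma horner_poly_of_P x : poly_of_P.[x] = polyP x.
Proof. by rewrite (horner_poly7 _ _ _ _ _ _ _ x).1 /polyP; ring. Qed.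

Lemma horner_deriv_poly_of_P x : (deriv poly_of_P).[x] = dpolyP x.
Proof. by rewrite (horner_poly7 _ _ _ _ _ _ _ x).2 /dpolyP; ring. Qed.

Lemma bernstein_ge0 a b x i j :
  a <= x <= b -> 0 <= (x - a) ^+ i * (b - x) ^+ j.
Proof. by move=> /andP[ax xb]; rewrite mulr_ge0 ?exprn_ge0 ?subr_ge0. Qed.

(* On [a, b] the sign is read off the coefficients in the Bernstein basis,     *)
(* which lra finds.                                                            *)
Ltac bernstein6 H :=
  have := (bernstein_ge0 6 0 H, bernstein_ge0 5 1 H, bernstein_ge0 4 2 H,
           bernstein_ge0 3 3 H, bernstein_ge0 2 4 H, bernstein_ge0 1 5 H,
           bernstein_ge0 0 6 H);
  move=> [[[[[[? ?] ?] ?] ?] ?] ?]; lra.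

Ltac bernstein5 H :=
  have := (bernstein_ge0 5 0 H, bernstein_ge0 4 1 H, bernstein_ge0 3 2 H,
           bernstein_ge0 2 3 H, bernstein_ge0 1 4 H, bernstein_ge0 0 5 H);
  move=> [[[[[? ?] ?] ?] ?] ?]; lra.

(** P is positive up to 13/10, decreasing on [13/10, 16/10], negative on [16/10, 18/10] and
    increasing afterwards. These four facts leave exactly one root in each of the two monotone
    pieces. *)
Lemma polyP_gt0 x : x <= 13 / 10 -> 0 < polyP x.
Proof.
rewrite /polyP => x1; have [x0|x0] := leP x 0.
  have H i : 0 <= (- x) ^+ i by rewrite exprn_ge0 // oppr_ge0.
  by have := (H 1, H 2, H 3, H 4, H 5, H 6);
    move=> [[[[[? ?] ?] ?] ?] ?]; lra.
have [x2|x2] := leP x (8 / 10).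
  have H : 0 <= x <= 8 / 10 by lra.
  by bernstein6 H.
have [x3|x3] := leP x (11 / 10).
  have H : 8 / 10 <= x <= 11 / 10 by lra.
  by bernstein6 H.
have H : 11 / 10 <= x <= 13 / 10 by lra.
by bernstein6 H.
Qed.

Lemma polyP_lt0 x : 16 / 10 <= x <= 18 / 10 -> polyP x < 0.
Proof. by rewrite /polyP => H; bernstein6 H. Qed.

Lemma dpolyP_lt0 x : 13 / 10 <= x <= 16 / 10 -> dpolyP x < 0.
Proof. by rewrite /dpolyP => H; bernstein5 H. Qed.

(** The expansion of P' in powers of x - 18/10 has no negative coefficient and a positive constant
    term. *)
Lemma dpolyP_gt0 x : 18 / 10 <= x -> 0 < dpolyP x.
Proof.
rewrite /dpolyP => x1.
have H i : 0 <= (x - 18 / 10) ^+ i by rewrite exprn_ge0 // subr_ge0.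
by have := (H 1, H 2, H 3, H 4, H 5); move=> [[[[? ?] ?] ?] ?]; lra.
Qed.

(** By Rolle's theorem, two distinct roots would enclose a zero of P'. *)
Lemma polyP_inj (I : F -> Prop) :
  (forall x y z, I x -> I y -> x <= z <= y -> dpolyP z != 0) ->
  forall x y, I x -> I y -> polyP x = 0 -> polyP y = 0 -> x = y.
Proof.
move=> dP; suff lt x y : I x -> I y -> polyP x = 0 -> polyP y = 0 -> ~~ (x < y).
  move=> x y Ix Iy Px Py; apply/eqP; rewrite eq_le !leNgt.
  by rewrite (lt y x) ?(lt x y).
move=> Ix Iy Px Py; apply/negP => xy.
have [z] : {z | z \in `]x, y[%R & (deriv poly_of_P).[z] = 0}.
  by apply: poly_rolle => //; rewrite !horner_poly_of_P Px Py.
rewrite in_itv /= horner_deriv_poly_of_P => /andP[xz zy] /eqP.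
by apply/negP/(dP x y) => //; rewrite !ltW.
Qed.

Lemma polyP_ivt_up (a b : F) : a <= b -> polyP a <= 0 <= polyP b ->
  exists2 c, a <= c <= b & polyP c = 0.
Proof.
rewrite -!horner_poly_of_P => ab Pab; have [c cab] := poly_ivt ab Pab.
by rewrite /root horner_poly_of_P => /eqP; exists c.
Qed.

Lemma polyP_ivt_down (a b : F) : a <= b -> polyP b <= 0 <= polyP a ->
  exists2 c, a <= c <= b & polyP c = 0.
Proof.
rewrite -!horner_poly_of_P => ab Pab.
have [|c cab] := @poly_ivt _ (- poly_of_P) _ _ ab.
  by rewrite !hornerN oppr_le0 oppr_ge0 andbC.
by rewrite rootN /root horner_poly_of_P => /eqP; exists c.
Qed.

Lemma polyP_roots : exists c c' : F,
  [/\ 13072873029%:R / 10000000000%:R <= c <= 1307287303%:R / 1000000000%:R,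
      c < c' & forall r, polyP r = 0 <-> r = c \/ r = c'].
Proof.
(* A bracket of width 10^-10, narrow enough for the five-digit values of M, N and L. *)
have [||c cb Pc] := @polyP_ivt_down
  (13072873029%:R / 10000000000%:R) (1307287303%:R / 1000000000%:R).
- by lra.
- by rewrite /polyP; lra.
have [||c' cb' Pc'] := @polyP_ivt_up (18 / 10) (19 / 10).
- by lra.
- by rewrite /polyP; lra.
exists c, c'; split; [exact: cb|lra|move=> r; split; last by case=> ->].
move=> Pr; have [r1|r1] := leP r (13 / 10).
  by have := polyP_gt0 r1; rewrite Pr ltxx.
have [r2|r2] := leP r (16 / 10).
  left; apply: (@polyP_inj (fun x => 13 / 10 <= x <= 16 / 10)) Pr Pc.
  - move=> x y z Hx Hy xz.
    by rewrite lt_eqF //; apply: dpolyP_lt0; apply/andP; split; lra.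
  - by apply/andP; split; lra.
  - by apply/andP; split; lra.
have [r3|r3] := leP r (18 / 10).
  have H : 16 / 10 <= r <= 18 / 10 by lra.
  by have := polyP_lt0 H; rewrite Pr ltxx.
right; apply: (@polyP_inj (fun x => 18 / 10 <= x)) Pr Pc'.
- move=> x y z Hx Hy xz.
  by rewrite gt_eqF //; apply: dpolyP_gt0; lra.
- by lra.
- by lra.
Qed.

End Roots.

Section Bounds.
Context {F : realFieldType}.

Lemma expr_le_small (d e : F) k : 0 <= d -> d <= e -> e <= 1 ->
  0 <= d ^+ k.+1 <= e.
Proof.
move=> d0 de e1; rewrite exprn_ge0 //=; apply: (le_trans _ de).
by rewrite exprS ler_piMr // exprn_ile1 // (le_trans de).
Qed.

(** Direct interval evaluation would suffer from cancellation between large terms. Expanding at the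
    left end of the bracket, c = c_0 + d, leaves a constant plus multiples of powers of d, which
    [lra] treats as independent unknowns in [0, 10^-9]. *)
Lemma numerical_values (c : F) (M := valM c) (N := valN c) (L := valL c) :
  13072873029%:R / 10000000000%:R <= c <= 1307287303%:R / 1000000000%:R ->
  [/\ `|M - 64706%:R / 100000%:R| < 1 / 200000%:R,
      `|c / 2 - 65364%:R / 100000%:R| < 1 / 200000%:R,
      `|N - 92376%:R / 100000%:R| < 1 / 200000%:R &
      `|L - 47661%:R / 100000%:R| < 1 / 200000%:R].
Proof.
move=> /andP[c1 c2].
have [d cE] : exists d, c = 13072873029%:R / 10000000000%:R + d.
  by exists (c - 13072873029%:R / 10000000000%:R); ring.
have d0 : 0 <= d by lra.
have d1 : d <= 1 / 1000000000%:R by lra.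
have e1 : (1 / 1000000000%:R : F) <= 1 by lra.
have dX k := expr_le_small k d0 d1 e1.
move: (dX 0%N) (dX 1%N) (dX 2) (dX 3) (dX 4).
rewrite /M /N /L /valM /valN /valL cE.
move=> /andP[? ?] /andP[? ?] /andP[? ?] /andP[? ?] /andP[? ?].
by clear dX c1 c2 cE e1; split; rewrite ltr_norml; apply/andP; split; lra.
Qed.

End Bounds.

(** * Sign of the Hessian coefficients *)

Section HessianCoefficients.
Context {F : realFieldType}.

Lemma dist_lt_itv (y a : F) :
  `|y - a| < 1 / 200000%:R -> a - 1 / 100000%:R <= y <= a + 1 / 100000%:R.
Proof. by rewrite ltr_norml => /andP[? ?]; apply/andP; split; lra. Qed.

Lemma numerical_gt0 (M h N L : F) :
  `|M - 64706%:R / 100000%:R| < 1 / 200000%:R ->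
  `|h - 65364%:R / 100000%:R| < 1 / 200000%:R ->
  `|N - 92376%:R / 100000%:R| < 1 / 200000%:R ->
  `|L - 47661%:R / 100000%:R| < 1 / 200000%:R ->
  [/\ 0 < M, 0 < h, 0 < N & 0 < L].
Proof.
move=> /dist_lt_itv/andP[? _] /dist_lt_itv/andP[? _] /dist_lt_itv/andP[? _].
by move=> /dist_lt_itv/andP[? _]; split; lra.
Qed.

Lemma mul_itv (y z y1 y2 z1 z2 : F) : 0 <= y1 -> 0 <= z1 ->
  y1 <= y <= y2 -> z1 <= z <= z2 -> y1 * z1 <= y * z <= y2 * z2.
Proof.
move=> y0 z0 /andP[? ?] /andP[? ?].
apply/andP; split; apply: ler_pM => //.
  exact: le_trans y0 _.
exact: le_trans z0 _.
Qed.

Lemma div_itv (y z y1 y2 z1 z2 l u : F) :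
  y1 <= y <= y2 -> z1 <= z <= z2 ->
  [/\ 0 < z1, 0 <= l, 0 <= u, l * z2 <= y1 & y2 <= u * z1] ->
  l <= y / z <= u.
Proof.
move=> /andP[y1y yy2] /andP[z1z zz2] [z10 l0 u0 lz uz].
have z0 : 0 < z by exact: lt_le_trans z1z.
rewrite ler_pdivlMr // ler_pdivrMr //.
rewrite (le_trans (ler_wpM2l l0 zz2)) ?(le_trans lz) //=.
by rewrite (le_trans yy2) // (le_trans uz) // ler_wpM2l.
Qed.

Implicit Types M h N L : F.

(* Coefficients of the Hessian in an S_3-adapted basis, S_3 permuting the      *)
(* first three indices.  The pairs {12,13,23}, {14,24,34}, {15,25,35}, {45}    *)
(* carry the metric values M, h, N, L; capital subscripts refer to the         *)
(* averages over the first three sets (the entry at 45 being eliminated by the *)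
(* trace condition), lower case ones to the deviations from these averages.    *)
Definition cAA M h N L : F := 3 / 2 * (1 / M) + 9 * (1 / L)
  - 3 / 10 * (M / (h * h)) - 3 / 10 * (M / (N * N))
  - 27 / 10 * (h / (N * L)) - 27 / 10 * (N / (h * L)) - 27 / 10 * (L / (h * N)).

Definition cBB M h N L : F := 3 * (1 / h) + 9 * (1 / L) - 6 / 5 * (M / (h * h))
  - 24 / 5 * (h / (N * L)) - 6 / 5 * (N / (h * L)) - 24 / 5 * (L / (h * N)).

Definition cDD M h N L : F := 3 * (1 / N) + 9 * (1 / L) - 6 / 5 * (M / (N * N))
  - 6 / 5 * (h / (N * L)) - 24 / 5 * (N / (h * L)) - 24 / 5 * (L / (h * N)).

Definition cAB M h N L : F := 9 * (1 / L) + 3 / 5 * (M / (h * h))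
  - 18 / 5 * (h / (N * L)) - 9 / 5 * (N / (h * L)) - 18 / 5 * (L / (h * N)).

Definition cAD M h N L : F := 9 * (1 / L) + 3 / 5 * (M / (N * N))
  - 9 / 5 * (h / (N * L)) - 18 / 5 * (N / (h * L)) - 18 / 5 * (L / (h * N)).

Definition cBD h N L : F := 9 * (1 / L)
  - 12 / 5 * (h / (N * L)) - 12 / 5 * (N / (h * L)) - 24 / 5 * (L / (h * N)).

Definition caa M h N : F :=
  1 / 5 * (1 / M) - 1 / 10 * (M / (h * h)) - 1 / 10 * (M / (N * N)).

Definition cbb M h N L : F := 1 / h - 3 / 5 * (1 / M) - 1 / 10 * (M / (h * h))
  - 1 / 10 * (h / (N * L)) - 1 / 10 * (N / (h * L)) - 1 / 10 * (L / (h * N)).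

Definition cdd M h N L : F := 1 / N - 3 / 5 * (1 / M) - 1 / 10 * (M / (N * N))
  - 1 / 10 * (h / (N * L)) - 1 / 10 * (N / (h * L)) - 1 / 10 * (L / (h * N)).

Definition cab M h : F := - (1 / 10 * (M / (h * h))).
Definition cad M N : F := - (1 / 10 * (M / (N * N))).
Definition cbd h N L : F := 1 / 10 * (h / (N * L)) + 1 / 10 * (N / (h * L))
  - 1 / 10 * (L / (h * N)).

(* The standard part is positive on the line a = -b, d = 0 and negative on its *)
(* complement a = b; the trivial part is positive on the plane D = 0 and       *)
(* negative on the line A = 0, B = -D.                                         *)
Lemma hess_coefs_sign M h N L :
  `|M - 64706%:R / 100000%:R| < 1 / 200000%:R ->
  `|h - 65364%:R / 100000%:R| < 1 / 200000%:R ->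
  `|N - 92376%:R / 100000%:R| < 1 / 200000%:R ->
  `|L - 47661%:R / 100000%:R| < 1 / 200000%:R ->
  [/\ 0 < caa M h N + cbb M h N L - 2 * cab M h,
      0 < cAA M h N L /\ cAB M h N L ^+ 2 < cAA M h N L * cBB M h N L,
      caa M h N + cbb M h N L + cdd M h N L
        + 2 * cab M h + 2 * cad M N + 2 * cbd h N L < 0 /\
      (cdd M h N L + cad M N + cbd h N L) ^+ 2 <
        (caa M h N + cbb M h N L + cdd M h N L
        + 2 * cab M h + 2 * cad M N + 2 * cbd h N L) * cdd M h N L &
      cBB M h N L + cDD M h N L - 2 * cBD h N L < 0].
Proof.
move=> /dist_lt_itv bM /dist_lt_itv bh /dist_lt_itv bN /dist_lt_itv bL.
have one : (1 : F) <= (1 : F) <= (1 : F).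
  by rewrite lexx.
have kM : 154400%:R / 100000%:R <= 1 / M <= 154700%:R / 100000%:R.
  by apply: (div_itv one bM); split; clear; lra.
have kh : 152900%:R / 100000%:R <= 1 / h <= 153100%:R / 100000%:R.
  by apply: (div_itv one bh); split; clear; lra.
have kN : 108200%:R / 100000%:R <= 1 / N <= 108400%:R / 100000%:R.
  by apply: (div_itv one bN); split; clear; lra.
have kL : 209700%:R / 100000%:R <= 1 / L <= 209900%:R / 100000%:R.
  by apply: (div_itv one bL); split; clear; lra.
have kMh : 151300%:R / 100000%:R <= M / (h * h) <= 151500%:R / 100000%:R.
  apply: (div_itv bM (mul_itv _ _ bh bh)); by [clear; lra|split; clear; lra].
have kMN : 75700%:R / 100000%:R <= M / (N * N) <= 75900%:R / 100000%:R.
  apply: (div_itv bM (mul_itv _ _ bN bN)); by [clear; lra|split; clear; lra].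
have kh1 : 148400%:R / 100000%:R <= h / (N * L) <= 148600%:R / 100000%:R.
  apply: (div_itv bh (mul_itv _ _ bN bL)); by [clear; lra|split; clear; lra].
have kN1 : 296400%:R / 100000%:R <= N / (h * L) <= 296600%:R / 100000%:R.
  apply: (div_itv bN (mul_itv _ _ bh bL)); by [clear; lra|split; clear; lra].
have kL1 : 78800%:R / 100000%:R <= L / (h * N) <= 79000%:R / 100000%:R.
  apply: (div_itv bL (mul_itv _ _ bh bN)); by [clear; lra|split; clear; lra].
(* The nine quotients now become independent variables in rational boxes; except for the two
   determinants, the claims are linear in them. *)
move: kM kh kN kL kMh kMN kh1 kN1 kL1.
rewrite /cAA /cBB /cDD /cAB /cBD /caa /cbb /cdd /cab /cad /cbd.
move: (1 / M) (1 / h) (1 / N) (1 / L) (M / (h * h)) (M / (N * N)).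
move: (h / (N * L)) (N / (h * L)) (L / (h * N)).
clear; move=> a1 a2 a3 a4 a5 a6 a7 a8 a9.
move=> /andP[? ?] /andP[? ?] /andP[? ?] /andP[? ?] /andP[? ?] /andP[? ?].
move=> /andP[? ?] /andP[? ?] /andP[? ?].
(* A determinant is bounded below by enclosing its off-diagonal entry in [- b0, b0] and its diagonal
   entries from below. *)
have sqr_lt (b A B b0 : F) : 0 <= b0 -> - b0 <= b <= b0 -> b0 ^+ 2 < A * B ->
    b ^+ 2 < A * B.
  move=> b00; rewrite -ler_norml => bb; apply: le_lt_trans.
  by rewrite -[b ^+ 2]real_normK ?num_real // lerXn2r ?nnegrE.
split.
- lra.
- split; first lra.
  apply: (sqr_lt _ _ _ (63 / 10)); [lra|lra|].
  apply: (@lt_le_trans _ _ (63 / 10 * (71 / 10))); first lra.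
  apply: ler_pM; lra.
- split; first lra.
  apply: (sqr_lt _ _ _ (15600%:R / 100000%:R)); [lra|lra|].
  (* Both diagonal entries are negative; their opposites are at least 15/100 and 44/100. *)
  rewrite -[X in _ < X]mulrNN; apply: (@lt_le_trans _ _ (15 / 100 * (44 / 100))).
    lra.
  apply: ler_pM; lra.
- lra.
Qed.

End HessianCoefficients.

(** * The metric g4 *)

Local Notation i0 := (@Ordinal 5 0 isT).
Local Notation i1 := (@Ordinal 5 1 isT).
Local Notation i2 := (@Ordinal 5 2 isT).
Local Notation i3 := (@Ordinal 5 3 isT).
Local Notation i4 := (@Ordinal 5 4 isT).

Section Flag5.
Context {R : realType}.

Lemma ord5P (i : 'I_5) : [\/ i = i0, i = i1, i = i2 | i = i3 \/ i = i4].
Proof.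
case: i => [[|[|[|[|[|//]]]]] ii].
- by apply: Or41; apply: val_inj.
- by apply: Or42; apply: val_inj.
- by apply: Or43; apply: val_inj.
- by apply: Or44; left; apply: val_inj.
- by apply: Or44; right; apply: val_inj.
Qed.

Lemma pair5P (P : 'I_5 -> 'I_5 -> Prop) :
  [/\ P i0 i1, P i0 i2, P i0 i3 & P i0 i4] ->
  [/\ P i1 i2, P i1 i3 & P i1 i4] -> P i2 i3 /\ P i2 i4 -> P i3 i4 ->
  forall k : pair_idx 5, P (val k).1 (val k).2.
Proof.
move=> [P01 P02 P03 P04] [P12 P13 P14] [P23 P24] P34 [[i j] /= ij].
by move: ij; case: (ord5P i) => [->|->|->|[->|->]];
  case: (ord5P j) => [->|->|->|[->|->]].
Qed.

Lemma big5 (F : 'I_5 -> R) :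
  \sum_i F i = F i0 + F i1 + F i2 + F i3 + F i4.
Proof.
rewrite !big_ord_recl big_ord0 addr0 !addrA.
by do 4?congr (_ + _); congr F; apply: val_inj.
Qed.

Lemma sum_pair5 (F : 'I_5 -> 'I_5 -> R) :
  \sum_(k : pair_idx 5) F (val k).1 (val k).2 =
  F i0 i1 + F i0 i2 + F i0 i3 + F i0 i4 + F i1 i2 + F i1 i3 + F i1 i4
  + F i2 i3 + F i2 i4 + F i3 i4.
Proof.
rewrite sum_pair_idx; under eq_bigr => i _ do rewrite big_mkcond big5.
by rewrite big5 /=; ring.
Qed.

Lemma sym_of_lex (s : seq R) (i j : 'I_5) : (i < j)%N ->
  sym (of_lex 5 s) i j = nth 0 s (index (val i, val j) (lex_pairs 5)).
Proof.
move=> ij; have := sym_val (of_lex 5 s) (Sub (i, j) ij : pair_idx 5).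
by rewrite SubK => ->; rewrite ffunE SubK.
Qed.

Section Metric.
Variables M h N L : R.
Hypotheses (M0 : 0 < M) (h0 : 0 < h) (N0 : 0 < N) (L0 : 0 < L).

Definition g4 : tuple_of R 5 := of_lex 5 [:: M; M; h; N; M; h; N; h; N; L].

Lemma g4E :
  [/\ sym g4 i0 i1 = M, sym g4 i0 i2 = M, sym g4 i0 i3 = h & sym g4 i0 i4 = N]
  /\ [/\ sym g4 i1 i2 = M, sym g4 i1 i3 = h & sym g4 i1 i4 = N]
  /\ (sym g4 i2 i3 = h /\ sym g4 i2 i4 = N) /\ sym g4 i3 i4 = L.
Proof.
by split; [split|split; [split|split; [split|]]]; rewrite sym_of_lex.
Qed.

Lemma g4_metric : is_metric g4.
Proof.
have [[x01 x02 x03 x04] [[x12 x13 x14] [[x23 x24] x34]]] := g4E.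
move=> k; rewrite -(sym_val g4).
apply: (@pair5P (fun i j => 0 < sym g4 i j));
  by rewrite ?(x01, x02, x03, x04, x12, x13, x14, x23, x24, x34).
Qed.

(** The invariant inner product of the standard representation of S_3: the sum of y_i z_i over three
    deviations with sum zero, the third one being eliminated. *)
Definition S3form (y1 y2 z1 z2 : R) : R :=
  2 * y1 * z1 + 2 * y2 * z2 + y1 * z2 + y2 * z1.

(** As Schur's lemma predicts, averages and deviations do not mix, and deviations pair only through
    [S3form]. An edge among the first three indices is labelled by its opposite vertex, so that the
    deviations a, b, d transform alike under S_3. *)
Lemma hess_g4 (p : 'I_5 -> 'I_5 -> R) (A B D a1 a2 b1 b2 d1 d2 : R) :
  (forall i j, p i j = p j i) ->
  [/\ p i1 i2 = A + a1, p i0 i2 = A + a2 & p i0 i1 = A - a1 - a2] ->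
  [/\ p i0 i3 = B + b1, p i1 i3 = B + b2 & p i2 i3 = B - b1 - b2] ->
  [/\ p i0 i4 = D + d1, p i1 i4 = D + d2 & p i2 i4 = D - d1 - d2] ->
  p i3 i4 = -3 * (A + B + D) ->
  hess g4 p p =
    cAA M h N L * A ^+ 2 + cBB M h N L * B ^+ 2 + cDD M h N L * D ^+ 2
    + 2 * cAB M h N L * A * B + 2 * cAD M h N L * A * D
    + 2 * cBD h N L * B * D
    + caa M h N * S3form a1 a2 a1 a2 + cbb M h N L * S3form b1 b2 b1 b2
    + cdd M h N L * S3form d1 d2 d1 d2 + 2 * cab M h * S3form a1 a2 b1 b2
    + 2 * cad M N * S3form a1 a2 d1 d2 + 2 * cbd h N L * S3form b1 b2 d1 d2.
Proof.
move=> pC [p12 p02 p01] [p03 p13 p23] [p04 p14 p24] p34.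
have [[x01 x02 x03 x04] [[x12 x13 x14] [[x23 x24] x34]]] := g4E.
(* In triangles with two equal edges the marked weight simplifies, which leaves only nine distinct
   quotients. *)
have tw (y : R) : 0 < y -> forall z, y / (z * y) = 1 / z.
  by move=> y0 z; rewrite invfM mulrCA mulfV ?gt_eqF // mulr1 mul1r.
have tw' (y : R) : 0 < y -> forall z, y / (y * z) = 1 / z.
  by move=> y0 z; rewrite [y * z]mulrC tw.
rewrite /hess (sum_pair5 (fun i j => p i j * p i j / sym g4 i j
  + (2 * 5)%:R^-1 * \sum_(l | (l != i) && (l != j))
        (tri g4 i j l * excess p i j l * excess p i j l
         - tri g4 i l j * excess p i l j * excess p i l j
         - tri g4 j l i * excess p j l i * excess p j l i))).
do !rewrite big_mkcond big5 /=.
rewrite /tri /excess (pC i1 i0) (pC i2 i0) (pC i3 i0) (pC i4 i0) (pC i2 i1)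
  (pC i3 i1) (pC i4 i1) (pC i3 i2) (pC i4 i2) (pC i4 i3).
rewrite (symC g4 i1 i0) (symC g4 i2 i0) (symC g4 i3 i0) (symC g4 i4 i0)
  (symC g4 i2 i1) (symC g4 i3 i1) (symC g4 i4 i1) (symC g4 i3 i2)
  (symC g4 i4 i2) (symC g4 i4 i3).
rewrite x01 x02 x03 x04 x12 x13 x14 x23 x24 x34.
rewrite p01 p02 p03 p04 p12 p13 p14 p23 p24 p34.
rewrite !tw // !tw' // (mulrC L N) (mulrC L h) (mulrC N h).
rewrite /cAA /cBB /cDD /cAB /cAD /cBD /caa /cbb /cdd /cab /cad /cbd /S3form.
rewrite !div1r.
move: (h / (N * L)) (N / (h * L)) (L / (h * N)) (M / (h * h)) (M / (N * N)).
move=> k1 k2 k3 k4 k5; move: M^-1 h^-1 N^-1 L^-1 => k6 k7 k8 k9.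
by field.
Qed.

End Metric.

End Flag5.

Lemma tensor_scale (R : realType) (n : nat) (c : R) (v : tuple_of R n) X Y :
  tensor (c *: v) X Y = c * tensor v X Y.
Proof.
rewrite /tensor mulr_sumr; apply: eq_bigr => k _.
by rewrite ffunE -mulrA.
Qed.

Lemma ric_Einstein (R : realType) (n : nat) (c : R) (x : tuple_of R n) :
  is_metric x -> ric x = c *: x -> Einstein x c.
Proof. by move=> x0 xE X Y pX pY; rewrite RicciE // xE tensor_scale. Qed.

(** Completing the square: a q = (a y + b z)^2 + (a c - b^2) z^2. *)
Lemma quad_pos (F : realFieldType) (a b c y z : F) : 0 < a -> b ^+ 2 < a * c ->
  0 <= a * y ^+ 2 + 2 * b * y * z + c * z ^+ 2 /\
  (a * y ^+ 2 + 2 * b * y * z + c * z ^+ 2 <= 0 -> y = 0 /\ z = 0).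
Proof.
move=> a0 bac; set q := _ + _.
have E : a * q = (a * y + b * z) ^+ 2 + (a * c - b ^+ 2) * z ^+ 2.
  by rewrite /q; ring.
have d0 : 0 < a * c - b ^+ 2 by rewrite subr_gt0.
have s1 := sqr_ge0 (a * y + b * z).
have s2 : 0 <= (a * c - b ^+ 2) * z ^+ 2 by rewrite mulr_ge0 ?sqr_ge0 ?ltW.
split; first by rewrite -(pmulr_rge0 _ a0) E addr_ge0.
rewrite -(pmulr_rle0 _ a0) E => le0.
have z0 : z = 0.
  have : (a * c - b ^+ 2) * z ^+ 2 == 0.
    by rewrite eq_le s2 andbT (le_trans _ le0) // lerDr.
  by rewrite mulf_eq0 gt_eqF //= sqrf_eq0 => /eqP.
split=> //; move: le0; rewrite z0 mulr0 addr0 expr0n mulr0 addr0 => le0.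
have : (a * y) ^+ 2 == 0 by rewrite eq_le le0 sqr_ge0.
by rewrite sqrf_eq0 mulf_eq0 gt_eqF //= => /eqP.
Qed.

Section G4.
Context {R : realType}.
Variables M h N L : R.
Hypotheses (M0 : 0 < M) (h0 : 0 < h) (N0 : 0 < N) (L0 : 0 < L).
Local Notation g4 := (g4 M h N L).

(** The hypotheses are the equations for p_12, p_14, p_15, p_45 (indices from 1) with Einstein
    constant 1/2, cleared of denominators. The other six pairs repeat them by symmetry. *)
Lemma ric_g4 :
  5 * (h * N) ^+ 2 + M ^+ 2 * (N ^+ 2 + h ^+ 2) = 10 * M * (h * N) ^+ 2 ->
  10 * (h * N * L) - 2 * (M * N * L) + h * (h ^+ 2 - N ^+ 2 - L ^+ 2) =
    10 * h * (h * N * L) ->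
  10 * (h * N * L) - 2 * (M * h * L) + N * (N ^+ 2 - h ^+ 2 - L ^+ 2) =
    10 * N * (h * N * L) ->
  10 * (h * N) + 3 * (L ^+ 2 - h ^+ 2 - N ^+ 2) = 10 * L * (h * N) ->
  ric g4 = (1 / 2) *: g4.
Proof.
move=> E12 E14 E15 E45; apply/ffunP => k; rewrite ffunE.
have -> : ((1 / 2) *: g4) k = 1 / 2 * sym g4 (val k).1 (val k).2.
  by rewrite ffunE sym_val.
have [[x01 x02 x03 x04] [[x12 x13 x14] [[x23 x24] x34]]] := g4E M h N L.
have [M1 h1] : M != 0 /\ h != 0 by split; rewrite gt_eqF.
have [N1 L1] : N != 0 /\ L != 0 by split; rewrite gt_eqF.
have e12 : 1 / 2 + ((M ^+ 2 - M ^+ 2 - M ^+ 2) / (M * M)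
     + (M ^+ 2 - h ^+ 2 - h ^+ 2) / (h * h)
     + (M ^+ 2 - N ^+ 2 - N ^+ 2) / (N * N)) / (4 * 5)%:R = 1 / 2 * M.
  transitivity ((5 * (h * N) ^+ 2 + M ^+ 2 * (N ^+ 2 + h ^+ 2))
     / (20 * (h * N) ^+ 2)); first by field; rewrite M1 h1 N1.
  by rewrite E12; field; rewrite h1 N1.
have e14 : 1 / 2 + ((h ^+ 2 - M ^+ 2 - h ^+ 2) / (M * h)
     + (h ^+ 2 - M ^+ 2 - h ^+ 2) / (M * h)
     + (h ^+ 2 - N ^+ 2 - L ^+ 2) / (N * L)) / (4 * 5)%:R = 1 / 2 * h.
  transitivity ((10 * (h * N * L) - 2 * (M * N * L)
     + h * (h ^+ 2 - N ^+ 2 - L ^+ 2)) / (20 * (h * N * L))).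
    by field; rewrite M1 h1 N1 L1.
  by rewrite E14; field; rewrite h1 N1 L1.
have e15 : 1 / 2 + ((N ^+ 2 - M ^+ 2 - N ^+ 2) / (M * N)
     + (N ^+ 2 - M ^+ 2 - N ^+ 2) / (M * N)
     + (N ^+ 2 - h ^+ 2 - L ^+ 2) / (h * L)) / (4 * 5)%:R = 1 / 2 * N.
  transitivity ((10 * (h * N * L) - 2 * (M * h * L)
     + N * (N ^+ 2 - h ^+ 2 - L ^+ 2)) / (20 * (h * N * L))).
    by field; rewrite M1 h1 N1 L1.
  by rewrite E15; field; rewrite h1 N1 L1.
have e45 : 1 / 2 + ((L ^+ 2 - h ^+ 2 - N ^+ 2) / (h * N)
     + (L ^+ 2 - h ^+ 2 - N ^+ 2) / (h * N)
     + (L ^+ 2 - h ^+ 2 - N ^+ 2) / (h * N)) / (4 * 5)%:R = 1 / 2 * L.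
  transitivity ((10 * (h * N) + 3 * (L ^+ 2 - h ^+ 2 - N ^+ 2))
     / (20 * (h * N))); first by field; rewrite h1 N1.
  by rewrite E45; field; rewrite h1 N1.
apply: (@pair5P (fun i j => ric_coef g4 i j = 1 / 2 * sym g4 i j));
  [split|split|split|]; rewrite /ric_coef big_mkcond big5 /=.
all: rewrite ?(symC g4 i1 i0) ?(symC g4 i2 i0) ?(symC g4 i3 i0)
  ?(symC g4 i4 i0) ?(symC g4 i2 i1) ?(symC g4 i3 i1) ?(symC g4 i4 i1)
  ?(symC g4 i3 i2) ?(symC g4 i4 i2) ?(symC g4 i4 i3)
  ?(x01, x02, x03, x04, x12, x13, x14, x23, x24, x34).
all: by rewrite !(add0r, addr0) ?e12 ?e14 ?e15 ?e45.
Qed.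

Lemma ratioC n (x v : tuple_of R n) i j : ratio x v i j = ratio x v j i.
Proof. by rewrite /ratio !(symC _ i). Qed.

Lemma ratio_mul n (x u : tuple_of R n) i j : is_metric x ->
  ratio x [ffun k => x k * u k] i j = sym u i j.
Proof.
move=> x0; have [->|ij] := eqVneq i j; first by rewrite /ratio !sym_diag mul0r.
have xij : sym x i j != 0 by rewrite gt_eqF ?sym_gt0.
rewrite /ratio; have -> : sym [ffun k => x k * u k] i j = sym x i j * sym u i j.
  apply: (@symP _ _ _ (fun i j r => r = sym x i j * sym u i j)) => // k.
    by rewrite ffunE !sym_val.
  by rewrite ffunE !(symC _ (val k).2) !sym_val.
by rewrite mulrAC mulfV ?mul1r.
Qed.

Section Coordinates.
Variable x : tuple_of R 5.
Hypothesis x0 : is_metric x.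

Definition avg_a v : R := (ratio x v i1 i2 + ratio x v i0 i2 + ratio x v i0 i1) / 3.
Definition avg_b v : R := (ratio x v i0 i3 + ratio x v i1 i3 + ratio x v i2 i3) / 3.
Definition avg_d v : R := (ratio x v i0 i4 + ratio x v i1 i4 + ratio x v i2 i4) / 3.

(* The four coordinates in which the Hessian is positive; they are dual to     *)
(* [pos_vector].                                                               *)
Definition pos_coord (v : tuple_of R 5) : 'rV[R]_4 :=
  \row_a nth 0 [:: (ratio x v i1 i2 - avg_a v - (ratio x v i0 i3 - avg_b v)) / 2;
                   (ratio x v i0 i2 - avg_a v - (ratio x v i1 i3 - avg_b v)) / 2;
                   avg_a v; avg_b v + avg_d v] a.

(** Relative variations in lexicographic order, with deviations a = (p1, p2), b = -a, d = 0 and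
    averages A, B, 0; the last entry makes the trace vanish. The complement, given by the kernel of
    [pos_coord], is a = b, A = 0, B = -D. *)
Definition pos_seq (t : 'rV[R]_4) : seq R :=
  let p1 := t 0 (@Ordinal 4 0 isT) in let p2 := t 0 (@Ordinal 4 1 isT) in
  let A := t 0 (@Ordinal 4 2 isT) in let B := t 0 (@Ordinal 4 3 isT) in
  [:: A - p1 - p2; A + p2; B - p1; 0; A + p1; B - p2; 0; B + p1 + p2; 0;
      -3 * (A + B)].

Definition pos_vector (t : 'rV[R]_4) : tuple_of R 5 :=
  [ffun k => x k * of_lex 5 (pos_seq t) k].

Lemma pos_coord_is_linear : linear pos_coord.
Proof.
move=> a v w; have lin i j :
    ratio x (a *: v + w) i j = a * ratio x v i j + ratio x w i j.
  by have := ratio_lin x v w a 1 i j; rewrite scale1r mul1r.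
apply/rowP => -[[|[|[|[|//]]]] m4];
  rewrite !mxE /= /avg_a /avg_b /avg_d !lin; by field.
Qed.

Lemma nth_pos_seq_linear a s t m :
  nth 0 (pos_seq (a *: s + t)) m =
  a * nth 0 (pos_seq s) m + nth 0 (pos_seq t) m.
Proof.
rewrite /pos_seq !mxE.
by do 10?[case: m => [|m] /=; first by ring]; rewrite !nth_nil mulr0 addr0.
Qed.

Lemma pos_vector_is_linear : linear pos_vector.
Proof.
move=> a s t; apply/ffunP => k.
have E u : pos_vector u k = x k *
    nth 0 (pos_seq u) (index (val (val k).1, val (val k).2) (lex_pairs 5)).
  by rewrite !ffunE.
have -> : (a *: pos_vector s + pos_vector t) k =
    a * pos_vector s k + pos_vector t k by rewrite ffunE [X in X + _]ffunE.
by rewrite !E nth_pos_seq_linear; ring.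
Qed.

End Coordinates.

End G4.

HB.instance Definition _ (R : realType) (x : tuple_of R 5) :=
  GRing.isLinear.Build R (tuple_of R 5) 'rV[R]_4 _ (pos_coord x)
    (pos_coord_is_linear x).

HB.instance Definition _ (R : realType) (x : tuple_of R 5) :=
  GRing.isLinear.Build R 'rV[R]_4 (tuple_of R 5) _ (pos_vector x)
    (pos_vector_is_linear x).

(** * The positive and the negative subspace of g4 *)

Section Definiteness.
Context {R : realType}.
Implicit Types (x v : tuple_of R 5) (t : 'rV[R]_4).
Local Notation j0 := (@Ordinal 4 0 isT).
Local Notation j1 := (@Ordinal 4 1 isT).
Local Notation j2 := (@Ordinal 4 2 isT).
Local Notation j3 := (@Ordinal 4 3 isT).

Lemma TT_ratio x v : is_metric x -> TT x v <->
  ratio x v i0 i1 + ratio x v i0 i2 + ratio x v i0 i3 + ratio x v i0 i4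
  + ratio x v i1 i2 + ratio x v i1 i3 + ratio x v i1 i4
  + ratio x v i2 i3 + ratio x v i2 i4 + ratio x v i3 i4 = 0.
Proof.
move=> x0; rewrite -(sum_pair5 (ratio x v)) TT_E //.
by under eq_bigr => k _ do rewrite -(sym_val v) -(sym_val x).
Qed.

Lemma ratio_eq0 x v : is_metric x ->
  [/\ ratio x v i0 i1 = 0, ratio x v i0 i2 = 0, ratio x v i0 i3 = 0
    & ratio x v i0 i4 = 0] ->
  [/\ ratio x v i1 i2 = 0, ratio x v i1 i3 = 0 & ratio x v i1 i4 = 0] ->
  ratio x v i2 i3 = 0 /\ ratio x v i2 i4 = 0 -> ratio x v i3 i4 = 0 -> v = 0.
Proof.
move=> x0 e0 e1 e2 e3; apply/ffunP => k; rewrite [RHS]ffunE.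
have := @pair5P (fun i j => ratio x v i j = 0) e0 e1 e2 e3 k.
rewrite /ratio !sym_val => /eqP; rewrite mulf_eq0 invr_eq0.
by rewrite (gt_eqF (x0 k)) orbF => /eqP.
Qed.

Lemma ratio_pos_vector x t : is_metric x ->
  let v := pos_vector x t in
  [/\ ratio x v i1 i2 = t 0 j2 + t 0 j0, ratio x v i0 i2 = t 0 j2 + t 0 j1
    & ratio x v i0 i1 = t 0 j2 - t 0 j0 - t 0 j1] /\
  [/\ ratio x v i0 i3 = t 0 j3 - t 0 j0, ratio x v i1 i3 = t 0 j3 - t 0 j1
    & ratio x v i2 i3 = t 0 j3 + t 0 j0 + t 0 j1] /\
  [/\ ratio x v i0 i4 = 0, ratio x v i1 i4 = 0 & ratio x v i2 i4 = 0] /\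
  ratio x v i3 i4 = -3 * (t 0 j2 + t 0 j3).
Proof.
move=> x0 v; split; [split|split; [split|split; [split|]]];
  by rewrite ratio_mul // sym_of_lex.
Qed.

Lemma pos_vectorK x : is_metric x -> cancel (pos_vector x) (pos_coord x).
Proof.
move=> x0 t; have [[e12 e02 e01] [[e03 e13 e23] [[e04 e14 e24] e34]]] :=
  ratio_pos_vector t x0.
apply/rowP => -[[|[|[|[|//]]]] m4]; rewrite mxE /avg_a /avg_b /avg_d
  ?e12 ?e02 ?e01 ?e03 ?e13 ?e23 ?e04 ?e14 ?e24 /=;
  rewrite (bool_irrelevance m4 isT); by field.
Qed.

Lemma TT_pos_vector x t : is_metric x -> TT x (pos_vector x t).
Proof.
move=> x0; have [[e12 e02 e01] [[e03 e13 e23] [[e04 e14 e24] e34]]] :=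
  ratio_pos_vector t x0.
rewrite TT_ratio // e12 e02 e01 e03 e13 e23 e04 e14 e24 e34; ring.
Qed.

Variables (M h N L r : R).
Hypothesis r0 : 0 < r.
Hypothesis bM : `|M - 64706%:R / 100000%:R| < 1 / 200000%:R.
Hypothesis bh : `|h - 65364%:R / 100000%:R| < 1 / 200000%:R.
Hypothesis bN : `|N - 92376%:R / 100000%:R| < 1 / 200000%:R.
Hypothesis bL : `|L - 47661%:R / 100000%:R| < 1 / 200000%:R.
Hypotheses (M0 : 0 < M) (h0 : 0 < h) (N0 : 0 < N) (L0 : 0 < L).
Local Notation x := (r *: g4 M h N L).

Lemma scaled_g4_metric : is_metric x.
Proof.
move=> k; rewrite ffunE; apply: mulr_gt0 => //.
exact: (g4_metric M0 h0 N0 L0).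
Qed.

Lemma Sc_hessian_g4 v : Sc_hessian x v v =
  r^-1 * hess (g4 M h N L) (ratio x v) (ratio x v).
Proof. by rewrite Sc_hessianE ?hess_scale ?gt_eqF //; exact: scaled_g4_metric. Qed.

(** With D = 0, d = 0 and b = -a the form is a binary form in the averages A, B plus a positive
    multiple of p1^2 + p2^2 + (p1 + p2)^2. *)
Lemma Sc_hessian_pos t : t != 0 ->
  0 < Sc_hessian x (pos_vector x t) (pos_vector x t).
Proof.
move=> t0; rewrite Sc_hessian_g4; set v := pos_vector x t.
rewrite pmulr_rgt0 ?invr_gt0 // ltNge; apply: contraNN t0.
have [e1 [e2 [e3 e4]]] := ratio_pos_vector t scaled_g4_metric.
have [[e03 e13 e23] [e04 e14 e24]] := (e2, e3).
rewrite (@hess_g4 _ _ _ _ _ M0 h0 N0 _ (t 0 j2) (t 0 j3) 0 (t 0 j0) (t 0 j1)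
  (- t 0 j0) (- t 0 j1) 0 0); first last.
- by rewrite e4 addr0.
- by rewrite e04 e14 e24; split; ring.
- by rewrite e03 e13 e23; split; ring.
- exact: e1.
- exact: ratioC.
have [q1 [q2 q3] _ _] := hess_coefs_sign bM bh bN bL.
have [s1 s2] := quad_pos (t 0 j2) (t 0 j3) q2 q3.
rewrite /S3form; set p1 := t 0 j0; set p2 := t 0 j1.
set A := t 0 j2; set B := t 0 j3; set c := caa _ _ _ + _ - _ in q1.
move=> le0; have E : cAA M h N L * A ^+ 2 + 2 * cAB M h N L * A * B
    + cBB M h N L * B ^+ 2
    + c * (p1 ^+ 2 + p2 ^+ 2 + (p1 + p2) ^+ 2) <= 0.
  by apply: le_trans le0; rewrite le_eqVlt; apply/orP; left; apply/eqP;
    rewrite /c; ring.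
have u0 : 0 <= p1 ^+ 2 + p2 ^+ 2 + (p1 + p2) ^+ 2 by rewrite !addr_ge0 ?sqr_ge0.
have cu0 : 0 <= c * (p1 ^+ 2 + p2 ^+ 2 + (p1 + p2) ^+ 2).
  exact: mulr_ge0 (ltW q1) u0.
have [A0 B0] : A = 0 /\ B = 0 by apply: s2; apply: le_trans E; rewrite lerDl.
have : c * (p1 ^+ 2 + p2 ^+ 2 + (p1 + p2) ^+ 2) <= 0.
  by apply: le_trans E; rewrite lerDr.
rewrite pmulr_rle0 // => u1.
have p10 : p1 = 0.
  by apply/eqP; rewrite -sqrf_eq0 eq_le sqr_ge0 andbT; apply: le_trans u1;
    rewrite -addrA lerDl addr_ge0 ?sqr_ge0.
have p20 : p2 = 0.
  by apply/eqP; rewrite -sqrf_eq0 eq_le sqr_ge0 andbT; apply: le_trans u1;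
    rewrite addrAC lerDr addr_ge0 ?sqr_ge0.
apply/eqP/rowP => -[[|[|[|[|//]]]] m4]; rewrite mxE.
- by rewrite -p10; congr (t _ _); apply: val_inj.
- by rewrite -p20; congr (t _ _); apply: val_inj.
- by rewrite -A0; congr (t _ _); apply: val_inj.
- by rewrite -B0; congr (t _ _); apply: val_inj.
Qed.

(** On the complement the trivial part is a negative multiple of B^2, and the standard part is a sum
    of three values of one negative definite binary form. *)
Lemma Sc_hessian_neg v : TT x v -> pos_coord x v = 0 -> v != 0 ->
  Sc_hessian x v v < 0.
Proof.
move=> vT v0; rewrite Sc_hessian_g4 pmulr_rlt0 ?invr_gt0 // ltNge => nv.
apply: contraNN nv.
have x0 := scaled_g4_metric; move/(TT_ratio _ x0): vT => vT.
move/rowP: v0 => v0; move: (v0 j0) (v0 j1) (v0 j2) (v0 j3).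
rewrite !mxE /= => c1 c2 A0 BD.
set A := avg_a x v in c1 c2 A0; set B := avg_b x v in c1 c2 BD.
set D := avg_d x v in BD; have EB : B = - D by rewrite -[B](addrK D) BD sub0r.
(* Here m is the common deviation a = b and n = d - a; in these coordinates the standard part has
   the matrix whose determinant is estimated in [hess_coefs_sign]. *)
pose m1 := ratio x v i1 i2; pose m2 := ratio x v i0 i2.
pose n1 := ratio x v i0 i4 - D - m1; pose n2 := ratio x v i1 i4 - D - m2.
have e01 : ratio x v i0 i1 = 0 - m1 - m2.
  by rewrite -{1}A0 /A /avg_a /m1 /m2; move: A0; rewrite /A /avg_a; lra.
have e03 : ratio x v i0 i3 = B + m1 by rewrite /m1; lra.
have e13 : ratio x v i1 i3 = B + m2 by rewrite /m2; lra.
have e23 : ratio x v i2 i3 = B - m1 - m2.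
  have : B = avg_b x v by []; rewrite /avg_b e03 e13; lra.
have e04 : ratio x v i0 i4 = D + (m1 + n1) by rewrite /n1; ring.
have e14 : ratio x v i1 i4 = D + (m2 + n2) by rewrite /n2; ring.
have e24 : ratio x v i2 i4 = D - (m1 + n1) - (m2 + n2).
  have : D = avg_d x v by []; rewrite /avg_d e04 e14; lra.
have e34 : ratio x v i3 i4 = -3 * (0 + B + D).
  move: vT; rewrite e01 e03 e13 e23 e04 e14 e24 -/m1 -/m2; lra.
rewrite (@hess_g4 _ _ _ _ _ M0 h0 N0 _ 0 B D m1 m2 m1 m2 (m1 + n1) (m2 + n2));
  first last.
- exact: e34.
- by split.
- by split.
- by split; [rewrite add0r|rewrite add0r|exact: e01].
- exact: ratioC.
have [_ _ [q1 q2] q3] := hess_coefs_sign bM bh bN bL.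
set al := caa _ _ _ + _ + _ + _ + _ + _ in q1 q2.
set be := _ + _ + _ in q2; set ga := cdd _ _ _ _ in q2 *; set c := _ + _ - _ in q3.
have q1' : 0 < - al by rewrite oppr_gt0.
have q2' : (- be) ^+ 2 < - al * - ga by rewrite sqrrN mulrNN.
(* The three deviations enter as (m1, n1), (m2, n2) and, up to sign, (m1 + m2, n1 + n2). *)
have [s1 s1'] := quad_pos m1 n1 q1' q2'.
have [s2 s2'] := quad_pos m2 n2 q1' q2'.
have [s3 _] := quad_pos (m1 + m2) (n1 + n2) q1' q2'.
have s4 : 0 <= - c * B ^+ 2 by rewrite mulr_ge0 ?sqr_ge0 // oppr_ge0 ltW.
rewrite /S3form => ge0.
have E : - c * B ^+ 2
    + (- al * m1 ^+ 2 + 2 * - be * m1 * n1 + - ga * n1 ^+ 2)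
    + (- al * m2 ^+ 2 + 2 * - be * m2 * n2 + - ga * n2 ^+ 2)
    + (- al * (m1 + m2) ^+ 2 + 2 * - be * (m1 + m2) * (n1 + n2)
       + - ga * (n1 + n2) ^+ 2) <= 0.
  rewrite -oppr_ge0; apply: le_trans ge0 _; rewrite le_eqVlt; apply/orP; left.
  by apply/eqP; rewrite EB /c /al /be /ga; ring.
set t0 := - c * _ in E s4; set t1 := - al * m1 ^+ 2 + _ + _ in E s1 s1'.
set t2 := - al * m2 ^+ 2 + _ + _ in E s2 s2'; set t3 := _ + _ + _ in s3 E.
have t1le : t1 <= 0 by lra.
have t2le : t2 <= 0 by lra.
have t0le : t0 <= 0 by lra.
have [m10 n10] := s1' t1le; have [m20 n20] := s2' t2le.
have B0 : B = 0.
  apply/eqP; rewrite -sqrf_eq0 eq_le sqr_ge0 andbT.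
  by move: t0le; rewrite /t0 pmulr_rle0 // oppr_gt0.
have D0 : D = 0 by apply/eqP; rewrite -oppr_eq0 -EB B0.
apply/eqP/(ratio_eq0 x0); rewrite ?e01 ?e03 ?e13 ?e23 ?e04 ?e14 ?e24 ?e34.
- by split; rewrite -/m2 ?m10 ?m20 ?n10 ?B0 ?D0; ring.
- by split; rewrite -/m1 ?m10 ?m20 ?n20 ?B0 ?D0; ring.
- by rewrite m10 m20 n10 n20 B0 D0; split; ring.
- by rewrite B0 D0; ring.
Qed.

End Definiteness.

Lemma scaled_g4_stability (R : realType) (M h N L r : R) : 0 < r ->
  `|M - 64706%:R / 100000%:R| < 1 / 200000%:R ->
  `|h - 65364%:R / 100000%:R| < 1 / 200000%:R ->
  `|N - 92376%:R / 100000%:R| < 1 / 200000%:R ->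
  `|L - 47661%:R / 100000%:R| < 1 / 200000%:R ->
  is_metric (g4 M h N L) ->
  [/\ nondegenerate (r *: g4 M h N L), unstable (r *: g4 M h N L)
    & coindex (r *: g4 M h N L) 4].
Proof.
move=> r0 bM bh bN bL g0.
have [M0 h0 N0 L0] := numerical_gt0 bM bh bN bL.
have x0 := scaled_g4_metric r0 M0 h0 N0 L0; set x := r *: _ in x0 *.
have K : cancel (pos_vector x) (pos_coord x) by exact: pos_vectorK.
have T t : TT x (pos_vector x t) by exact: TT_pos_vector.
have pos t : t != 0 -> 0 < Sc_hessian x (pos_vector x t) (pos_vector x t).
  exact: Sc_hessian_pos.
have neg v : TT x v -> pos_coord x v = 0 -> v != 0 -> Sc_hessian x v v < 0.
  exact: Sc_hessian_neg.
split.
- exact: (split_nondegenerate x0 K T pos neg).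
- exact: (split_unstable T pos).
- exact: (split_coindex K T pos neg).
Qed.

Lemma unit_rescaling_scale (R : realType) (n : nat) (volQ : R)
    (x : tuple_of R n) : 0 < volQ -> is_metric x ->
  exists2 r : R, 0 < r & unit_rescaling volQ x = r *: x.
Proof.
move=> vol0 x0; eexists; last by [].
by apply: powR_gt0; rewrite mulr_gt0 // prodr_gt0.
Qed.

Lemma root_g4_properties (R : realType) (volQ c : R) : 0 < volQ ->
  13072873029%:R / 10000000000%:R <= c <= 1307287303%:R / 1000000000%:R ->
  polyP c = 0 ->
  let x := g4 (valM c) (c / 2) (valN c) (valL c) in
  is_metric x /\ (exists rho : R, Einstein x rho /\ 2 * rho = 1) /\
  nondegenerate (unit_rescaling volQ x) /\ unstable (unit_rescaling volQ x) /\
  coindex (unit_rescaling volQ x) 4.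
Proof.
move=> vol0 cb Pc; have [bM bh bN bL] := numerical_values cb.
have e12 := einstein12 Pc; have e14 := einstein14 Pc.
have e15 := einstein15 Pc; have e45 := einstein45 Pc.
(* From here on c is forgotten: only the numerical bounds and the four equations are kept. *)
move: (valM c) (valN c) (valL c) (c / 2) bM bh bN bL e12 e14 e15 e45.
move=> M N L h bM bh bN bL e12 e14 e15 e45 x.
have [M0 h0 N0 L0] := numerical_gt0 bM bh bN bL.
have g0 : is_metric x by exact: g4_metric.
split; first exact: g0.
split.
  exists (1 / 2); split; last by field.
  exact: ric_Einstein g0 (ric_g4 M0 h0 N0 L0 e12 e14 e15 e45).
have [r r0 ->] := unit_rescaling_scale vol0 g0.
by have [? ? ?] := scaled_g4_stability r0 bM bh bN bL g0.
Qed.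

Close Scope complex_scope.

Theorem proposition8p8 (R : realType) (volQ : R) (hvolQ : 0 < volQ) :
  let P (x : R) : R :=
    17500%:R * x ^+ 6 - 113750%:R * x ^+ 5 + 316325%:R * x ^+ 4 - 490500%:R * x ^+ 3
    + 447800%:R * x ^+ 2 - 225550%:R * x + 48503%:R in
  exists c c' : R,
    [/\ c < c', (forall r : R, P r = 0 <-> r = c \/ r = c'),
        `|c - 13073%:R / 10000%:R| < 1 / 20000%:R &
     let M : R :=
       8971375%:R / 1666862%:R * c ^+ 5 - 98032375%:R / 3333724%:R * c ^+ 4
       + 446084445%:R / 6667448%:R * c ^+ 3 - 68439950%:R / 833431%:R * c ^+ 2
       + 357123741%:R / 6667448%:R * c - 109792137%:R / 8334310%:R in
     let N : R :=
       268587215%:R / 13334896%:R - 930186785%:R / 13334896%:R * c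
       + 1387293825%:R / 13334896%:R * c ^+ 2 - 1110422865%:R / 13334896%:R * c ^+ 3
       + 239341375%:R / 6667448%:R * c ^+ 4 - 21499625%:R / 3333724%:R * c ^+ 5 in
     let L : R :=
       10670625%:R / 3333724%:R * c ^+ 5 - 129829875%:R / 6667448%:R * c ^+ 4
       + 654761925%:R / 13334896%:R * c ^+ 3 - 876763875%:R / 13334896%:R * c ^+ 2
       + 627815565%:R / 13334896%:R * c - 183414881%:R / 13334896%:R in
     let h : R := c / 2 in
     let g4 : tuple_of R 5 := of_lex 5 [:: M; M; h; N; M; h; N; h; N; L] in
     let g4_unit : tuple_of R 5 := unit_rescaling volQ g4 in
     [/\ `|M - 64706%:R / 100000%:R| < 1 / 200000%:R,
         `|h - 65364%:R / 100000%:R| < 1 / 200000%:R,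
         `|N - 92376%:R / 100000%:R| < 1 / 200000%:R &
         `|L - 47661%:R / 100000%:R| < 1 / 200000%:R] /\
     is_metric g4 /\
     (exists rho : R, Einstein g4 rho /\ 2 * rho = 1) /\
     nondegenerate g4_unit /\
     unstable g4_unit /\
     coindex g4_unit 4].
Proof.
move=> P; have [c [c' [cb cc' roots]]] := @polyP_roots R.
have Pc : polyP c = 0 by apply/roots; left.
exists c, c'; split; [exact: cc'|exact: roots| |].
  by rewrite ltr_norml; apply/andP; split; lra.
split; first exact: (numerical_values cb).
exact: (root_g4_properties hvolQ cb Pc).
Qed.
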